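(* Let $d\ge4$ and $\gamma>1$. There exists a constant $C=C(d,\gamma)>0$ depending only on $d$ and $\gamma$ such that for every $G\in L^2(\mathbb{R}\times\mathbb{S}^{d-1})$ $$\left(\sum_{k=-\infty}^{\infty}\|\mathcal{R}^*G\|^2_{L^{2d}(\{x\in\mathbb{R}^d:\gamma^k<|x|\leq\gamma^{k+1}\})}\right)^{1/2}\leq C\,\|G\|_{L^2(\mathbb{R}\times\mathbb{S}^{d-1})}.$$
   Context: The adjoint Radon transform is the operator $$(\mathcal{R}^*G)(x)=\int_{\mathbb{S}^{d-1}}G(x\cdot\omega,\omega)\,d\omega,\qquad x\in\mathbb{R}^d,$$ where $d\omega$ is the standard surface measure on the unit sphere $\mathbb{S}^{d-1}\subset\mathbb{R}^d$; for $G\in L^2$ the formula is understood for almost every $x$. $L^2(\mathbb{R}\times\mathbb{S}^{d-1})$ is taken with respect to $ds\,d\omega$. *)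

(* Defs.v *)
From HB Require Import structures.
From mathcomp Require Import all_boot all_order all_algebra.
From mathcomp Require Import all_classical all_reals all_analysis.
From mathcomp Require Import measurable_realfun complex.

Set Implicit Arguments.
Unset Strict Implicit.
Unset Printing Implicit Defensive.

Import Order.TTheory GRing.Theory Num.Theory.
Import numFieldNormedType.Exports.

Local Open Scope classical_set_scope.
Local Open Scope ring_scope.

(* R^n is n.-tuple R with the product (= Borel) sigma-algebra of the library. *)

Section euclidean.
Context {R : realType}.
Implicit Types n : nat.

Definition dotp n (x y : n.-tuple R) : R :=
  \sum_(i < n) tnth x i * tnth y i.

Definition enorm n (x : n.-tuple R) : R := Num.sqrt (dotp x x).

(* The unit sphere of R^n, of dimension n - 1. *)
Definition sphere n : set (n.-tuple R) := [set x | enorm x = 1].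

Definition shell n (gamma : R) (k : int) : set (n.-tuple R) :=
  [set x | gamma ^ k < enorm x <= gamma ^ (k + 1)].

Definition punctured_ball n : set (n.-tuple R) :=
  [set x | 0 < enorm x <= 1].

Definition direction n (x : n.-tuple R) : n.-tuple R :=
  [tuple tnth x i / enorm x | i < n].

#[global] Arguments sphere : clear implicits.
#[global] Arguments shell : clear implicits.
#[global] Arguments punctured_ball : clear implicits.

Lemma dotp_ge0 n (x : n.-tuple R) : 0 <= dotp x x.
Proof. by apply: sumr_ge0 => i _; rewrite -expr2 sqr_ge0. Qed.

Lemma measurable_enorm n : measurable_fun [set: n.-tuple R] (@enorm n).
Proof.
rewrite (_ : @enorm n = fun x => dotp x x `^ 2^-1); last first.
  by apply/funext => x; rewrite powR12_sqrt// dotp_ge0.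
apply: (@measurableT_comp _ _ _ _ _ _ (@powR R ^~ 2^-1)).
  exact: measurable_powR.
apply: measurable_sum => i; apply: measurable_funM; exact: measurable_tnth.
Qed.

Lemma measurable_direction n : measurable_fun [set: n.-tuple R] (@direction n).
Proof.
apply/measurable_fun_tnthP => i.
rewrite (_ : _ \o _ = fun x => tnth x i * (enorm x `^ (-1))); last first.
  by apply/funext => x /=; rewrite tnth_mktuple powR_inv1// sqrtr_ge0.
apply: measurable_funM; first exact: measurable_tnth.
apply: (@measurableT_comp _ _ _ _ _ _ (@powR R ^~ (-1))).
  exact: measurable_powR.
exact: measurable_enorm.
Qed.

Lemma measurable_sphere n : measurable (sphere n).
Proof.
rewrite (_ : sphere n = setT `&` @enorm n @^-1` [set 1]); last first.
  by rewrite setTI.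
exact: measurable_enorm.
Qed.

Lemma measurable_punctured_ball n : measurable (punctured_ball n).
Proof.
rewrite (_ : punctured_ball n = setT `&` @enorm n @^-1` `]0, 1]).
  by apply: measurable_enorm => //; exact: measurable_itv.
by rewrite setTI; apply/seteqP; split=> x; rewrite /= in_itv.
Qed.

Lemma measurable_shell n gamma k : measurable (shell n gamma k).
Proof.
rewrite (_ : shell n gamma k =
  setT `&` @enorm n @^-1` `]gamma ^ k, gamma ^ (k + 1)]).
  by apply: measurable_enorm => //; exact: measurable_itv.
by rewrite setTI; apply/seteqP; split=> x; rewrite /= in_itv.
Qed.

Lemma enorm_direction n (x : n.-tuple R) :
  0 < enorm x -> enorm (direction x) = 1.
Proof.
move=> x0; rewrite /enorm.
have -> : dotp (direction x) (direction x) = dotp x x / enorm x ^+ 2.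
  rewrite /dotp mulr_suml; apply: eq_bigr => i _.
  by rewrite tnth_mktuple mulrACA expr2 invfM.
have xx : dotp x x = enorm x ^+ 2 by rewrite sqr_sqrtr// dotp_ge0.
by rewrite xx divff ?sqrtr1// expf_neq0// gt_eqF.
Qed.

Lemma tnth_le_enorm n (x : n.-tuple R) i : `|tnth x i| <= enorm x.
Proof.
rewrite -sqrtr_sqr; apply: ler_wsqrtr.
rewrite /dotp (bigD1 i)//= -expr2 lerDl.
by apply: sumr_ge0 => j _; rewrite -expr2 sqr_ge0.
Qed.

End euclidean.

Section cons_measure.
Context {R : realType} (n : nat).
Variable m : {sigma_finite_measure set (n.-tuple R) -> \bar R}.
Local Open Scope ereal_scope.

Definition tuple_cons (p : R * n.-tuple R) : n.+1.-tuple R :=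
  [tuple of p.1 :: p.2].

Definition tuple_uncons (t : n.+1.-tuple R) : R * n.-tuple R :=
  (thead t, [tuple of behead t]).

Lemma tuple_consK : cancel tuple_cons tuple_uncons.
Proof. by move=> [a t]; congr pair; apply/val_inj. Qed.

Lemma measurable_tuple_cons : measurable_fun [set: R * n.-tuple R] tuple_cons.
Proof. exact: measurable_cons. Qed.

Lemma measurable_tuple_uncons :
  measurable_fun [set: n.+1.-tuple R] tuple_uncons.
Proof.
apply: (measurable_fun_pair (f := fun t => thead t)
  (g := fun t => [tuple of behead t])); first exact: measurable_tnth.
exact: measurable_behead.
Qed.

(* The product of the Lebesgue measure of R with m, on R^(n+1). *)
Definition cons_measure : set (n.+1.-tuple R) -> \bar R :=
  pushforward (lebesgue_measure \x m) tuple_cons.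

Let cons_measure0 : cons_measure set0 = 0.
Proof. by rewrite /cons_measure /pushforward preimage_set0 measure0. Qed.

Let cons_measure_ge0 A : 0 <= cons_measure A.
Proof. by rewrite /cons_measure /pushforward; exact: measure_ge0. Qed.

Let cons_measure_sigma_additive : semi_sigma_additive cons_measure.
Proof.
have mc := measurable_tuple_cons.
exact: measure_semi_sigma_additive.
Qed.

HB.instance Definition _ := isMeasure.Build _ _ _ cons_measure
  cons_measure0 cons_measure_ge0 cons_measure_sigma_additive.

Let cons_measure_sigma_finite : sigma_finite setT cons_measure.
Proof.
have /sigma_finiteP[F [TF ndF Foo]] := sigma_finiteT (@lebesgue_measure R).
have /sigma_finiteP[G [TG ndG Goo]] := sigma_finiteT m.
exists (fun k => tuple_uncons @^-1` (F k `*` G k)).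
  rewrite -preimage_bigcup; apply/esym; rewrite -subTset => t _ /=.
  have : setT (tuple_uncons t).1 by [].
  rewrite TF => -[i _ Fi]; have : setT (tuple_uncons t).2 by [].
  rewrite TG => -[j _ Gj]; exists (maxn i j) => //; split.
  - by move: Fi; apply/subsetPset/ndF/leq_maxl.
  - by move: Gj; apply/subsetPset/ndG/leq_maxr.
move=> k; have [mFk Fk] := Foo k; have [mGk Gk] := Goo k; split.
  rewrite -[X in measurable X]setTI; apply: measurable_tuple_uncons => //.
  exact: measurableX.
rewrite /cons_measure /pushforward -comp_preimage.
rewrite (_ : _ \o _ = id); last by apply/funext => p; exact: tuple_consK.
by rewrite preimage_id product_measure1E// lte_mul_pinfty// ge0_fin_numE.
Qed.

HB.instance Definition _ := Measure_isSigmaFinite.Build _ _ _ cons_measure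
  cons_measure_sigma_finite.

End cons_measure.

Section lebesgue_tuple.
Context {R : realType}.
Local Open Scope ereal_scope.

Fixpoint lebesgue_tuple n : {sigma_finite_measure set (n.-tuple R) -> \bar R} :=
  if n is n'.+1 then cons_measure (lebesgue_tuple n')
  else dirac ([tuple] : 0.-tuple R).

Lemma measurable_box n (A : 'I_n -> set R) :
  (forall i, measurable (A i)) ->
  measurable [set x : n.-tuple R | forall i, A i (tnth x i)].
Proof.
move=> mA; rewrite (_ : [set _ | _] = \bigcap_(i in [set: 'I_n])
    (setT `&` (@tnth _ R ^~ i) @^-1` A i)).
  apply: fin_bigcap_measurable => // i _.
  by apply: measurable_tnth => //; exact: mA.
apply/seteqP; split=> x Ax i; first by move=> _; split => //; exact: Ax.
by have [] := Ax i I.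
Qed.

Lemma lebesgue_tuple_box n (A : 'I_n -> set R) :
  (forall i, measurable (A i)) ->
  lebesgue_tuple n [set x | forall i, A i (tnth x i)] =
  \prod_(i < n) lebesgue_measure (A i).
Proof.
elim: n A => [|n IH] A mA.
  by rewrite big_ord0 /= diracE mem_set// => -[].
have mB := @measurable_box n (fun i => A (lift ord0 i)) (fun=> mA _).
rewrite /= /cons_measure /pushforward big_ord_recl -IH//.
apply: etrans (@product_measure1E _ _ (measurableTypeR R) _ R
  lebesgue_measure (lebesgue_tuple n) _ _ (mA ord0) mB); congr (_ _).
apply/seteqP; split=> -[a t] /=.
  by move=> H; split=> [|i]; [exact: (H ord0)|rewrite -(tnthS a); exact: H].
by move=> [Aa At] i; case: (unliftP ord0 i) => [j ->|->//]; rewrite tnthS.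
Qed.

End lebesgue_tuple.

Arguments lebesgue_tuple R n : clear implicits.

Section sphere_measure.
Context {R : realType}.
Local Open Scope ereal_scope.

(* Surface measure of the unit sphere, as a measure on R^n, where it is
   concentrated on the sphere (see sphere_measure_setC): by polar
   coordinates, sigma(A) is n times the volume of the set of those x in the
   unit ball with x / |x| in A. *)
Definition sphere_measure n : set (n.-tuple R) -> \bar R :=
  pushforward (mscale (n%:R%:nng)%R
      (mrestr (lebesgue_tuple R n) (@measurable_punctured_ball R n)))
    (@direction R n).

#[global] Arguments sphere_measure : clear implicits.

Section instances.
Variable n : nat.

Let sphere_measure0 : sphere_measure n set0 = 0.
Proof.
by rewrite /sphere_measure /pushforward preimage_set0 measure0.
Qed.

Let sphere_measure_ge0 A : 0 <= sphere_measure n A.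
Proof. by rewrite mule_ge0//; exact: measure_ge0. Qed.

Let sphere_measure_sigma_additive : semi_sigma_additive (sphere_measure n).
Proof.
have md := @measurable_direction R n.
exact: measure_semi_sigma_additive.
Qed.

HB.instance Definition _ := isMeasure.Build _ _ _ (sphere_measure n)
  sphere_measure0 sphere_measure_ge0 sphere_measure_sigma_additive.

Let lebesgue_punctured_ball_lty :
  lebesgue_tuple R n (punctured_ball n) < +oo.
Proof.
pose Q : 'I_n -> set R := fun=> `[(-1)%R, 1%R]%classic.
have mQ i : measurable (Q i) by exact: measurable_itv.
apply: (@le_lt_trans _ _ (\prod_(i < n) lebesgue_measure (Q i))).
  rewrite -lebesgue_tuple_box//; apply: le_measure; rewrite ?inE.
  - exact: measurable_punctured_ball.
  - exact: measurable_box.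
  - move=> x /= /andP[_ x1] i; rewrite /Q /= in_itv/= -ler_norml.
    exact: le_trans (tnth_le_enorm x i) x1.
apply: (proj2 (big_ind (fun y => 0 <= y /\ y < +oo) _ _ _)).
- by split; [exact: lee01|exact: ltry].
- move=> x y [x0 xy] [y0 yy].
  by rewrite mule_ge0// lte_mul_pinfty// ge0_fin_numE.
- move=> i _; split; first exact: measure_ge0.
  by rewrite lebesgue_measure_itv/=; case: ifP => _; rewrite ltry.
Qed.

Let sphere_measure_fin : fin_num_fun (sphere_measure n).
Proof.
move=> A mA; rewrite ge0_fin_numE// lte_mul_pinfty//.
apply: le_lt_trans lebesgue_punctured_ball_lty.
apply: le_measure; rewrite ?inE//.
- apply: measurableI; last exact: measurable_punctured_ball.
  by rewrite -[X in measurable X]setTI; exact: measurable_direction.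
- exact: measurable_punctured_ball.
Qed.

HB.instance Definition _ := Measure_isFinite.Build _ _ _ (sphere_measure n)
  sphere_measure_fin.

End instances.

Lemma sphere_measure_setC n : sphere_measure n (~` sphere n) = 0.
Proof.
have E : @direction R n @^-1` (~` sphere n) `&` punctured_ball n = set0.
  apply/seteqP; split=> // x [/= + /andP[x0 _]]; apply.
  exact: enorm_direction.
transitivity (n%:R%:E * lebesgue_tuple R n set0); first by rewrite -E.
by rewrite measure0 mule0.
Qed.

End sphere_measure.

Arguments sphere_measure R n _ : clear implicits.

Section complex_valued.
Context d (T : measurableType d) (R : realType).
Variables (mu : {measure set T -> \bar R}) (D : set T).
Implicit Type f : T -> R[i].

Definition cmeasurable_fun f : Prop :=
  measurable_fun D (fun x => complex.Re (f x)) /\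
  measurable_fun D (fun x => complex.Im (f x)).

Definition cintegrable f : Prop :=
  mu.-integrable D (fun x => (complex.Re (f x))%:E) /\
  mu.-integrable D (fun x => (complex.Im (f x))%:E).

Definition cintegral f : R[i] :=
  Complex (\int[mu]_(x in D) complex.Re (f x))
          (\int[mu]_(x in D) complex.Im (f x)).

(* g \_ D is g set to 0 outside D, so this is the norm of L^p(D, mu). *)
Definition cLnorm (p : R) f : \bar R :=
  'N[mu]_(p%:E)[(fun x => (Normc.normc (f x))%:E) \_ D]%E.

Definition cLfun (p : R) f : Prop :=
  cmeasurable_fun f /\ (cLnorm p f < +oo)%E.

End complex_valued.

(* A function on the product of R and the sphere is represented by a function on
   R x R^d of which only the values on that product matter.  The integral is
   meaningful at those x where the integrand is cintegrable. *)
Definition adjoint_radon (R : realType) (d : nat) (G : R * d.-tuple R -> R[i])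
    (x : d.-tuple R) : R[i] :=
  cintegral (sphere_measure R d) (sphere d) (fun w => G (dotp x w, w)).

(* Main.v *)
Require Import Defs.
From HB Require Import structures.
From mathcomp Require Import all_boot all_order all_algebra.
From mathcomp Require Import all_classical all_reals all_analysis.
From mathcomp Require Import measurable_realfun complex.
From mathcomp Require Import ring lra zify.

(** The estimate is proved by duality, for the transform [u] of the modulus of
    [G], and rests on two facts about the kernel [1 / |x - y|].

    The first is the L2 theory of the Radon transform.  For a density [f >= 0]
    the squared L2 norm of its Radon transform is a multiple of the energy of
    [f] with respect to [1 / |x - y|].  Only an upper bound is needed, and no
    Radon transform has to be constructed: hyperplanes are replaced by slabs
    of width [2 * e], for which Young's inequality bounds the pairing of [f]
    with averages of [G] by the L2 norm of [G] and by the mass that [f] puts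
    on pairs of points with [|(x - y) . w| < 2 * e].  The surface measure of
    the directions [w] with this property is O([e / |x - y|])
    ([integral_win_sphere]), so the bound is uniform in [e]; Lebesgue's
    differentiation theorem and Fatou's lemma let [e] tend to 0.  The outcome
    is [radon_pairing_le]: the integral of [f * u] is at most
    [l * |G|^2 + (c / l) * newton_energy f] for every [l > 0].

    The second fact is that this energy is bounded by the l2 sum over the
    shells of the squared norms of [f] in L^p, where [p = 2d / (2d - 1)] is
    conjugate to [2d].  Writing [f = v ^ (2d - 1)] and normalising [v] in
    L^(2d), there are two cases.  Two functions on arbitrary sets satisfy the
    Hardy-Littlewood-Sobolev inequality ([newton_form_le]); since the two
    exponents coincide it has a short proof: order the two values, and split
    the kernel at the radius determined by the larger one ([riesz_below]).
    Functions on the distant shells [j < k] satisfy a better bound, with decay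
    [gamma ^ (- (k - j) / 2)], because the kernel is bounded by a multiple of
    [gamma ^ (- k)] there.  The matrix of these bounds is summed by Schur's
    test ([dual_energy]).

    Testing [radon_pairing_le] with the extremal [f] of the duality
    ([dual_function]) and absorbing the energy into the left-hand side gives
    the bound for [u] ([shell_norms_le]).  A first use with truncations of [u]
    shows that [u] is finite almost everywhere, so that the integral defining
    the adjoint Radon transform converges absolutely for almost every point; a
    second use with [u] itself gives the estimate. *)

Set Implicit Arguments.
Unset Strict Implicit.
Unset Printing Implicit Defensive.

Import Order.TTheory GRing.Theory Num.Theory.
Import numFieldNormedType.Exports.

Local Open Scope classical_set_scope.
Local Open Scope ring_scope.

(** * Pairing with averages of a function of one variable *)

Section monotone_integral.
Context d (T : measurableType d) (R : realType).
Variable mu : {measure set T -> \bar R}.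
Local Open Scope ereal_scope.

(** The integral of a nonnegative function is a supremum over the simple
    functions below it, hence monotone for arbitrary nonnegative functions.
    The adjoint Radon transform is compared with a majorant in this way. *)
Lemma le_integral_ge0 (f g : T -> \bar R) :
  (forall x, 0 <= f x) -> (forall x, f x <= g x) ->
  \int[mu]_x f x <= \int[mu]_x g x.
Proof.
move=> f0 fg; have g0 x : 0 <= g x := le_trans (f0 x) (fg x).
rewrite !ge0_integralTE//; apply: ereal_sup_le => _ [h /= hf <-].
by exists h => //= x; exact: le_trans (hf x) (fg x).
Qed.

End monotone_integral.

Section window.
Context {R : realType}.

Definition win (e r : R) : R := (`|r| < e)%R%:R.

Lemma win_ge0 e r : 0 <= win e r. Proof. exact: ler0n. Qed.

Lemma winE e : win e = \1_(`]-e, e[%classic).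
Proof.
by apply/funext => r; rewrite /win indicE mem_setE in_itv/= ltr_norml.
Qed.

Lemma measurable_win e : measurable_fun setT (win e).
Proof. by rewrite winE; apply: measurable_indic; exact: measurable_itv. Qed.

Lemma integral_win e s : 0 < e ->
  (\int[lebesgue_measure]_t (win e (s - t))%:E = (2 * e)%:E)%E.
Proof.
move=> e0; rewrite (_ : (fun t => _) = (EFin \o \1_(ball s e))).
  rewrite integral_indic//; last exact: measurable_ball.
  by rewrite setIT; have := lebesgue_measure_ball s (ltW e0); rewrite mulr_natl => <-.
apply/funext => t /=; rewrite /win indicE; congr (_%:R%:E); congr nat_of_bool.
by apply/idP/idP; rewrite inE /ball.
Qed.

End window.

(** Young's inequality with a free parameter stands in for the Cauchy-Schwarz
    inequality: the parameter is chosen in the very last step, and square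
    roots of integrals do not appear before it. *)
Lemma lee_amgm (R : realType) (l a : R) (b : \bar R) : 0 < l -> 0 <= a ->
  (0 <= b -> a%:E * b <= l%:E * (a ^+ 2)%:E + l^-1%:E * (b * b))%E.
Proof.
move=> l0 a0; case: b => [b| |]// b0; last first.
  rewrite mulyy [X in (_ <= _ + X)%E]gt0_muley ?lte_fin ?invr_gt0//.
  by rewrite addey// leey.
rewrite -!EFinM -EFinD lee_fin.
have := sqr_ge0 (l * a - b / 2).
have e : l * a ^+ 2 + l^-1 * (b * b) - a * b =
  l^-1 * ((l * a - b / 2) ^+ 2 + 3%:R / 4%:R * b ^+ 2).
  by field; rewrite gt_eqF.
move=> h; rewrite -subr_ge0 e mulr_ge0 ?invr_ge0 ?(ltW l0)//.
by move: h (sqr_ge0 b); lra.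
Qed.

Section averaged_pairing.
Context d (T : measurableType d) (R : realType).
Variable mu : {sigma_finite_measure set T -> \bar R}.
Variables (phi f : T -> R).
Hypotheses (mphi : measurable_fun setT phi) (mf : measurable_fun setT f).
Hypothesis f0 : forall x, 0 <= f x.
Local Open Scope ereal_scope.

Definition avg (e : R) (g : R -> R) (s : R) : \bar R :=
  (2 * e)^-1%:E * \int[lebesgue_measure]_t (g t * win e (s - t))%:E.

(** Divided by [2 * e], and for [phi] the scalar product with a unit vector
    [w], this approximates the Radon transform of [f] at [(t, w)]. *)
Definition slab_mass (e t : R) : \bar R :=
  \int[mu]_y (f y * win e (phi y - t))%:E.

Lemma slab_mass_ge0 e t : 0 <= slab_mass e t.
Proof. by apply: integral_ge0 => y _; rewrite lee_fin mulr_ge0// win_ge0. Qed.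

Lemma measurable_slab_integrand e :
  measurable_fun [set: T * R] (fun p => (f p.1 * win e (phi p.1 - p.2))%R).
Proof.
apply: measurable_funM; first exact: (measurableT_comp mf).
apply: (measurableT_comp (measurable_win e)); apply: measurable_funB.
  exact: (measurableT_comp mphi).
exact: measurable_snd.
Qed.

Lemma measurable_slab_mass e : measurable_fun [set: R] (slab_mass e).
Proof.
pose F (p : T * R) := (f p.1 * win e (phi p.1 - p.2))%:E.
apply: (@measurable_fun_fubini_tonelli_G _ _ _ _ _ mu F).
  by apply/measurable_EFinP; exact: measurable_slab_integrand.
by move=> p; rewrite lee_fin mulr_ge0// win_ge0.
Qed.

(** If [x] lies in the slab of half-width [e] around [t], then that slab is
    contained in the one of half-width [2 * e] around [phi x].  One of the two
    factors of the square can thus be replaced by a quantity free of [t], and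
    integrating the other one in [t] yields the length [2 * e] of a window. *)
Lemma slab_mass_sqr e : (0 < e)%R ->
  \int[lebesgue_measure]_t (slab_mass e t * slab_mass e t) <=
  (2 * e)%:E * \int[mu]_x ((f x)%:E * slab_mass (2 * e) (phi x)).
Proof.
move=> e0.
pose F (p : T * R) := (f p.1 * win e (phi p.1 - p.2))%:E * slab_mass e p.2.
have F0 p : 0 <= F p.
  by rewrite mule_ge0 ?slab_mass_ge0// lee_fin mulr_ge0// win_ge0.
have mF : measurable_fun setT F.
  apply: emeasurable_funM; first by apply/measurable_EFinP; exact: measurable_slab_integrand.
  exact: (measurableT_comp (measurable_slab_mass e)).
have -> : \int[lebesgue_measure]_t (slab_mass e t * slab_mass e t) =
    \int[lebesgue_measure]_t \int[mu]_x F (x, t).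
  apply: eq_integral => t _; rewrite -ge0_integralZr//.
  - exact/measurable_EFinP/(measurableT_comp (measurable_slab_integrand e) (pair2_measurable t)).
  - by move=> x _; rewrite lee_fin mulr_ge0// win_ge0.
  - exact: slab_mass_ge0.
rewrite -(@fubini_tonelli _ _ _ _ _ mu lebesgue_measure F)//.
have mQ : measurable_fun setT (fun x => (f x)%:E * slab_mass (2 * e) (phi x)).
  apply: emeasurable_funM; first exact/measurable_EFinP.
  exact: (measurableT_comp (measurable_slab_mass _)).
rewrite -ge0_integralZl//; last 2 first.
- by move=> x _; rewrite mule_ge0 ?slab_mass_ge0// lee_fin.
- by rewrite lee_fin mulr_ge0// ltW.
apply: le_integral_ge0 => x.
  by apply: integral_ge0 => t _; exact: F0.
rewrite /F/= -(integral_win (phi x) e0) muleC.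
rewrite -ge0_integralZl//; last 3 first.
- apply/measurable_EFinP/(measurableT_comp (measurable_win e)).
  exact: measurable_funB.
- by move=> t _; rewrite lee_fin win_ge0.
- by rewrite mule_ge0 ?slab_mass_ge0// lee_fin.
apply: le_integral_ge0 => t; first exact: (F0 (x, t)).
rewrite EFinM -muleA [leRHS]muleAC -muleA; apply: lee_pmul => //.
- by rewrite lee_fin.
- by rewrite mule_ge0 ?slab_mass_ge0// lee_fin win_ge0.
rewrite /win; have [ht|_] := ltP `|phi x - t|%R e; last by rewrite !mul0e.
rewrite !mul1e; apply: le_integral_ge0 => y.
  by rewrite lee_fin mulr_ge0// win_ge0.
rewrite lee_fin ler_wpM2l//; rewrite /win.
have [hy|_] := ltP `|phi y - t|%R e; last by rewrite ler0n.
rewrite (_ : (_ < _)%R = true)//.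
have -> : (phi y - phi x = (phi y - t) - (phi x - t))%R by ring.
by rewrite (le_lt_trans (ler_normB _ _))//; lra.
Qed.

(** By Tonelli's theorem the left-hand side is the pairing on the line of [g]
    with [slab_mass e / (2 * e)]; Young's inequality separates the two, and
    [slab_mass_sqr] bounds the square of the second. *)
Lemma averaged_pairing (g : R -> R) (e l : R) : measurable_fun setT g ->
  (forall t, 0 <= g t)%R -> (0 < e)%R -> (0 < l)%R ->
  \int[mu]_x ((f x)%:E * avg e g (phi x)) <=
  l%:E * \int[lebesgue_measure]_t (g t ^+ 2)%:E +
  l^-1%:E * ((2 * e)^-1%:E *
    \int[mu]_x ((f x)%:E * slab_mass (2 * e) (phi x))).
Proof.
move=> mg g0 e0 l0.
have e2 : (0 < (2 * e)^-1)%R by rewrite invr_gt0 mulr_gt0.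
have e2' := ltW e2.
have li : (0 <= l^-1)%R by rewrite invr_ge0 ltW.
pose F (p : T * R) := (f p.1 * win e (phi p.1 - p.2) * (g p.2 / (2 * e)))%:E.
have F0 p : 0 <= F p.
  by rewrite lee_fin !mulr_ge0// ?win_ge0// ltW.
have mgs : measurable_fun setT (fun t => g t / (2 * e))%R.
  by apply: measurable_funM.
have mF : measurable_fun setT F.
  apply/measurable_EFinP/measurable_funM; first exact: measurable_slab_integrand.
  exact: (measurableT_comp mgs).
have mw s : measurable_fun setT (fun t : R => win e (s - t)).
  by apply: (measurableT_comp (measurable_win e)); exact: measurable_funB.
have -> : \int[mu]_x ((f x)%:E * avg e g (phi x)) =
    \int[mu]_x \int[lebesgue_measure]_t F (x, t).
  apply: eq_integral => x _; rewrite /avg muleA -EFinM.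
  rewrite -ge0_integralZl//.
  - by apply: eq_integral => t _; rewrite /F -EFinM; congr EFin => /=; ring.
  - by apply/measurable_EFinP/measurable_funM; [exact: mg|exact: mw].
  - by move=> t _; rewrite lee_fin mulr_ge0// win_ge0.
  - by rewrite lee_fin mulr_ge0// ltW.
rewrite (@fubini_tonelli _ _ _ _ _ mu lebesgue_measure F)//.
apply: (@le_trans _ _ (\int[lebesgue_measure]_t
   (l%:E * (g t ^+ 2)%:E +
   (l^-1 * (2 * e)^-1 * (2 * e)^-1)%:E * (slab_mass e t * slab_mass e t)))).
  apply: le_integral_ge0 => t; first by apply: integral_ge0 => x _; exact: F0.
  have -> : \int[mu]_x F (x, t) = (g t / (2 * e))%:E * slab_mass e t.
    rewrite -ge0_integralZl//.
    - by apply: eq_integral => x _; rewrite /F -EFinM; congr EFin; exact: mulrC.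
    - exact/measurable_EFinP/(measurableT_comp (measurable_slab_integrand e) (pair2_measurable t)).
    - by move=> x _; rewrite lee_fin mulr_ge0// win_ge0.
    - by rewrite lee_fin mulr_ge0// ltW.
  rewrite EFinM -muleA; apply: (le_trans (lee_amgm l0 (g0 t) _)).
    by rewrite mule_ge0 ?slab_mass_ge0// lee_fin ltW.
  rewrite leeD2l// !EFinM !muleA.
  by rewrite [X in X * slab_mass e t <= _]muleAC.
rewrite ge0_integralD//; last 4 first.
- by move=> t _; rewrite mule_ge0// lee_fin ?sqr_ge0// ltW.
- apply: measurable_funeM; apply/measurable_EFinP.
  exact: measurable_funX.
- by move=> t _; rewrite mule_ge0// ?mule_ge0 ?slab_mass_ge0// lee_fin !mulr_ge0.
- apply: measurable_funeM.
  by apply: emeasurable_funM; exact: measurable_slab_mass.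
rewrite leeD//.
  rewrite ge0_integralZl//; last by rewrite lee_fin ltW.
  - exact/measurable_EFinP/measurable_funX.
  - by move=> t _; rewrite lee_fin sqr_ge0.
rewrite ge0_integralZl//; last 3 first.
- by apply: emeasurable_funM; exact: measurable_slab_mass.
- by move=> t _; rewrite mule_ge0 ?slab_mass_ge0.
- by rewrite lee_fin !mulr_ge0.
rewrite -[(l^-1 * _ * _)%R]mulrA EFinM -muleA lee_wpmul2l//.
rewrite EFinM -muleA lee_wpmul2l//.
rewrite muleC lee_pdivrMr ?invr_gt0 ?mulr_gt0// muleC.
exact: slab_mass_sqr.
Qed.

End averaged_pairing.

(** * Removing the averages *)

Section lebesgue_average.
Context {R : realType}.
Local Open Scope ereal_scope.

Let shrink (x : R) (n : nat) : set R := ball x n.+1%:R^-1%R.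

Let nicely_shrink x : nicely_shrinking x (shrink x).
Proof.
split=> [n|]; first exact: measurable_ball.
exists (1%R, fun n => PosNum (divr_gt0 ltr01 (ltr0Sn R n))); split => //=.
- under eq_fun do rewrite div1r.
  exact: cvg_harmonic.
- by move=> n; rewrite /shrink div1r.
- by move=> n; rewrite /shrink div1r mul1e.
Qed.

(** Lebesgue's differentiation theorem for the intervals of radius
    [1 / (n + 1)]. *)
Lemma cvg_avg (g : R -> R) (M : R) : measurable_fun setT g ->
  (forall t, 0 <= g t <= M)%R ->
  {ae lebesgue_measure, forall s : R, avg n.+1%:R^-1 g s @[n --> \oo] --> (g s)%:E}.
Proof.
move=> mg gM.
have lg : locally_integrable setT g.
  split => //; first exact: openT.
  move=> K _ cK; have mK := compact_measurable cK.
  apply: (@le_lt_trans _ _ (\int[lebesgue_measure]_(x in K) (M%:E))).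
    apply: ge0_le_integral => //.
    - by apply/measurable_EFinP/measurableT_comp => //; exact: measurable_funTS.
    - by move=> x _; rewrite lee_fin; have /andP[g0 g1] := gM x; rewrite ger0_norm.
  rewrite integral_cst// lte_mul_pinfty ?lee_fin//.
    by have /andP[g0 g1] := gM 0%R; exact: le_trans g1.
  exact: compact_finite_measure.
have [N [mN N0 sN]] := lebesgue_differentiation lg.
exists N; split => // s /= h; apply: sN => /= gs; apply: h.
move: gs => /(nice_lebesgue_differentiation nicely_shrink lg).
rewrite (_ : (fun n => _) = (fun n => avg n.+1%:R^-1 g s))//; apply/funext => n.
have n0 : (0 < n.+1%:R^-1 :> R)%R by rewrite invr_gt0.
rewrite /avg /shrink lebesgue_measure_ball ?ltW// -[(_ *+ 2)%R]mulr_natl.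
rewrite inver gt_eqF ?mulr_gt0//; congr (_ * _).
rewrite integral_mkcond; apply: eq_integral => t _.
rewrite patchE /win.
case: ifPn => [|]; [rewrite inE|rewrite notin_setE]; rewrite /ball/=.
  by move=> ->; rewrite mulr1.
by move/negP/negbTE => ->; rewrite mulr0.
Qed.

End lebesgue_average.

Section liminf.
Context {R : realType}.
Local Open Scope ereal_scope.
Implicit Types u v : (\bar R)^nat.

Lemma le_limn_einf u v : (forall n, u n <= v n) -> limn_einf u <= limn_einf v.
Proof.
move=> uv; rewrite !limn_einf_lim; apply: lee_lim; [exact: is_cvg_einfs..|].
apply: nearW => n; apply: le_ereal_inf_tmp => _ [k /= nk <-].
by apply: le_trans (uv k); apply: ereal_inf_lbound; exists k.
Qed.

Lemma limn_einf_cst (c : \bar R) : limn_einf (fun=> c) = c.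
Proof. by have [] := cvg_limn_einf_sup (@cvg_cst _ c nat \oo _). Qed.

Lemma measurable_fun_limn_einf d (T : measurableType d) (f : (T -> \bar R)^nat) :
  (forall n, measurable_fun setT (f n)) ->
  measurable_fun setT (fun x => limn_einf (f^~ x)).
Proof.
move=> mf.
rewrite (_ : (fun _ => _) = fun x => - limn_esup (fun n => - f n x)).
  apply: measurableT_comp => //.
  by apply: measurable_fun_limn_esup => n; exact: measurableT_comp.
apply/funext => x; rewrite -limn_einfN; congr limn_einf.
by apply/funext => n /=; rewrite oppeK.
Qed.

End liminf.

Section pairing_liminf.
Context d (T : measurableType d) (R : realType).
Variable mu : {sigma_finite_measure set T -> \bar R}.
Variables (phi f : T -> R).
Hypotheses (mphi : measurable_fun setT phi) (mf : measurable_fun setT f).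
Hypothesis f0 : forall x, 0 <= f x.
Hypothesis phi_null : forall N : set (measurableTypeR R),
  measurable N -> lebesgue_measure N = 0%E -> mu (phi @^-1` N) = 0%E.
Local Open Scope ereal_scope.

(** As [e] tends to 0, this is about twice the squared L2 norm of the density
    on the line of the image under [phi] of the measure [f mu]. *)
Definition slab_energy (e : R) : \bar R :=
  (2 * e)^-1%:E * \int[mu]_x ((f x)%:E * slab_mass mu phi f (2 * e) (phi x)).

Lemma measurable_avg (e : R) (g : R -> R) : measurable_fun setT g ->
  (forall t, 0 <= g t)%R -> measurable_fun setT (avg e g).
Proof.
move=> mg g0; apply: measurable_funeM.
pose F (p : R * R) := (g p.2 * win e (p.1 - p.2))%:E.
apply: (@measurable_fun_fubini_tonelli_F _ _ _ _ R lebesgue_measure F).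
  apply/measurable_EFinP/measurable_funM; first exact: (measurableT_comp mg).
  by apply: (measurableT_comp (measurable_win e)); apply: measurable_funB.
by move=> p; rewrite lee_fin mulr_ge0// win_ge0.
Qed.

Lemma avg_ge0 (e : R) (g : R -> R) s : (0 <= e)%R ->
  (forall t, 0 <= g t)%R -> 0 <= avg e g s.
Proof.
move=> e0 g0; rewrite mule_ge0//.
  by rewrite lee_fin invr_ge0 mulr_ge0.
by apply: integral_ge0 => t _; rewrite lee_fin mulr_ge0// win_ge0.
Qed.

(** The averages of [g] converge to [g] at almost every [phi x], since [phi]
    pulls null sets back to null sets; Fatou's lemma then removes the
    averaging from [averaged_pairing]. *)
Lemma pairing_le_liminf (g : R -> R) (M l : R) : measurable_fun setT g ->
  (forall t, 0 <= g t <= M)%R -> (0 < l)%R ->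
  \int[mu]_x (f x * g (phi x))%:E <=
  limn_einf (fun n => l%:E * \int[lebesgue_measure]_t (g t ^+ 2)%:E +
                      l^-1%:E * slab_energy n.+1%:R^-1).
Proof.
move=> mg gM l0; have g0 t : (0 <= g t)%R by have /andP[] := gM t.
have i0 n : (0 <= n.+1%:R^-1 :> R)%R by rewrite invr_ge0.
pose h n x := (f x)%:E * avg n.+1%:R^-1 g (phi x).
have h0 n x : 0 <= h n x by rewrite mule_ge0 ?avg_ge0// lee_fin.
have mh n : measurable_fun setT (h n).
  apply: emeasurable_funM; first exact/measurable_EFinP.
  by apply: (measurableT_comp _ mphi); exact: measurable_avg.
apply: (@le_trans _ _ (\int[mu]_x limn_einf (h^~ x))).
  apply: ae_ge0_le_integral => //.
  - by move=> x _; rewrite lee_fin mulr_ge0.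
  - apply/measurable_EFinP/measurable_funM => //.
    exact: (measurableT_comp mg).
  - by move=> x _; rewrite -(limn_einf_cst 0); exact: le_limn_einf.
  - exact: measurable_fun_limn_einf.
  have [N [mN N0 sN]] := cvg_avg mg gM.
  exists (phi @^-1` N); split.
  - by rewrite -[X in measurable X]setTI; exact: mphi.
  - exact: phi_null.
  - move=> x /= nx; apply: sN => /= cg; apply: nx => _.
    have : h^~ x @ \oo --> (f x)%:E * (g (phi x))%:E by exact: cvgeZl.
    by move=> /cvg_limn_einf_sup[-> _].
apply: (le_trans (fatou mu measurableT mh _)) => //.
apply: le_limn_einf => n; apply: averaged_pairing => //.

Qed.
End pairing_liminf.

(** * Slabs and hyperplanes in the cube *)

(** By uniqueness of Lebesgue measure on intervals, its image under the affine
    map is [1 / `|a|] times Lebesgue measure. *)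
Lemma affine_null (R : realType) (a c : R) (N : set (measurableTypeR R)) :
  a != 0 -> measurable N -> lebesgue_measure N = 0%E ->
  lebesgue_measure [set x : R | N (a * x + c)] = 0%E.
Proof.
move=> a0 mN N0.
have mphi : measurable_fun setT (fun x : measurableTypeR R => a * x + c : measurableTypeR R).
  by apply: measurable_funD => //; exact: measurable_funM.
have an : 0 < `|a| by rewrite normr_gt0.
pose m := mscale (NngNum (normr_ge0 a)) (pushforward lebesgue_measure
  (fun x : measurableTypeR R => a * x + c : measurableTypeR R)).
have : lebesgue_measure N = m mphi N.
  apply: (@lebesgue_measure_unique R (m mphi)) => // _ [[p q] _ <-]; rewrite /m /=.
  rewrite (_ : mscale _ _ _ = (`|a|%:E *
    lebesgue_measure [set x : R | `]p, q]%classic (a * x + c)%R])%E)//.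
  have [agt0|alt0|/esym/eqP] := ltgtP 0 a; last by rewrite (negbTE a0).
    rewrite (_ : [set x | _ (a * x + c)] = `](p - c) / a, (q - c) / a]%classic); last first.
      apply/seteqP; split=> x; rewrite /= !in_itv/=.
        by rewrite ltr_pdivrMr// ler_pdivlMr// ltrBlDr lerBrDr mulrC.
      by rewrite ltr_pdivrMr// ler_pdivlMr// ltrBlDr lerBrDr mulrC.
    rewrite !lebesgue_measure_itv/= !lte_fin ltr_pM2r ?invr_gt0// ltrD2r.
    case: ifP; rewrite ?mule0// -!EFinB -EFinM gtr0_norm// => _.
    by congr EFin; field.
  rewrite (_ : [set x | _ (a * x + c)] = `[(q - c) / a, (p - c) / a[%classic); last first.
    apply/seteqP; split=> x; rewrite /= !in_itv/=.
      by rewrite ler_ndivrMr// ltr_ndivlMr// ltrBlDr lerBrDr mulrC andbC.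
    by rewrite ler_ndivrMr// ltr_ndivlMr// ltrBlDr lerBrDr mulrC andbC.
  rewrite !lebesgue_measure_itv/= !lte_fin ltr_nM2r ?invr_lt0// ltrD2r.
  case: ifP; rewrite ?mule0// -!EFinB -EFinM ltr0_norm// => _.
  by congr EFin; field.
rewrite N0 /m /mscale/= => /esym/eqP; rewrite mule_eq0 eqe gt_eqF//= => /eqP.
exact.
Qed.

Section lebesgue_tuple_fubini.
Context {R : realType} (n : nat).
Local Open Scope ereal_scope.

Let cons_preimage (A : set (n.+1.-tuple R)) : measurable A ->
  measurable (@tuple_cons R n @^-1` A).
Proof.
by move=> mA; rewrite -[X in measurable X]setTI; exact: measurable_tuple_cons.
Qed.

Lemma lebesgue_tuple_head (A : set (n.+1.-tuple R)) : measurable A ->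
  lebesgue_tuple R n.+1 A =
  \int[lebesgue_measure]_a lebesgue_tuple R n [set t | A (tuple_cons (a, t))].
Proof.
move=> mA; apply: eq_integral => a _; congr (lebesgue_tuple R n _).
by apply/seteqP; split=> t; rewrite /xsection/= inE.
Qed.

(** The slices by the first coordinate are integrated either last, as in
    [lebesgue_tuple_head], or first, as here: the inductions below need the
    second order when the first coordinate is the one that is singled out. *)
Lemma lebesgue_tuple_behead (A : set (n.+1.-tuple R)) : measurable A ->
  lebesgue_tuple R n.+1 A =
  \int[lebesgue_tuple R n]_t lebesgue_measure [set a | A (tuple_cons (a, t))].
Proof.
move=> mA.
have := @product_measure_unique _ _ (measurableTypeR R) _ R lebesgue_measure
  (lebesgue_tuple R n) (lebesgue_measure \x^ lebesgue_tuple R n)%E.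
move=> /(_ _ _ (cons_preimage mA)) H; rewrite [LHS]H; last first.
  by move=> A1 A2 mA1 mA2; exact: product_measure2E.
apply: eq_integral => t _; congr (lebesgue_measure _).
by apply/seteqP; split=> a; rewrite /ysection/= inE.
Qed.

Lemma dotp_cons (z : n.+1.-tuple R) a t :
  dotp z (tuple_cons (a, t)) =
  (thead z * a + dotp [tuple of behead z] t)%R.
Proof.
rewrite /dotp big_ord_recl; congr (_ + _)%R.
apply: eq_bigr => i _; congr (_ * _)%R; last by rewrite tnthS.
by rewrite [z]tuple_eta tnthS; congr tnth; exact/val_inj.
Qed.

Lemma tnth_behead_lift (z : n.+1.-tuple R) j :
  tnth [tuple of behead z] j = tnth z (lift ord0 j).
Proof. by rewrite [z]tuple_eta tnthS; congr tnth; exact/val_inj. Qed.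

End lebesgue_tuple_fubini.

Section hyperplanes.
Context {R : realType}.
Local Open Scope ereal_scope.

Lemma measurable_set_normr_lt d (T : measurableType d) (f : T -> R) (e : R) :
  measurable_fun setT f -> measurable [set x | (`|f x| < e)%R].
Proof.
move=> mf; rewrite (_ : [set x | _] = setT `&` f @^-1` `](- e)%R, e[%classic).
  by apply: mf => //; exact: measurable_itv.
by rewrite setTI; apply/seteqP; split=> x; rewrite /= in_itv/= ltr_norml.
Qed.

Lemma measurable_dotp n (z : n.-tuple R) : measurable_fun setT (dotp z).
Proof.
apply: measurable_sum => i; apply: measurable_funM => //.
exact: measurable_tnth.
Qed.

Definition unit_cube n : set (n.-tuple R) :=
  [set x | forall i, `[(-1)%R, 1%R]%classic (tnth x i)].

Local Arguments unit_cube : clear implicits.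

Lemma measurable_unit_cube n : measurable (unit_cube n).
Proof. by apply: (@measurable_box _ n (fun=> _)) => i; exact: measurable_itv. Qed.

Lemma lebesgue_itvN11 : lebesgue_measure `[(-1)%R, 1%R : R]%classic = 2%:E.
Proof.
rewrite lebesgue_measure_itv/= lte_fin ifT; last by lra.
by rewrite -EFinB opprK.
Qed.

Lemma lebesgue_unit_cube n : lebesgue_tuple R n (unit_cube n) = (2 ^+ n)%:E.
Proof.
rewrite (@lebesgue_tuple_box _ n (fun=> _)); last by move=> i; exact: measurable_itv.
rewrite (eq_bigr (fun=> 2%:E)); first by rewrite prodEFin prodr_const card_ord.
by move=> i _; rewrite lebesgue_measure_itv/= lte_fin ifT -?EFinB; [congr EFin|]; lra.
Qed.

Lemma affine_slab (a c e : R) : a != 0%R -> (0 < e)%R ->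
  lebesgue_measure [set x : R | (`|a * x + c| < e)%R] = (2 * e / `|a|)%:E.
Proof.
move=> a0 e0; have a1 : (0 < `|a|)%R by rewrite normr_gt0.
rewrite (_ : [set x | _] = ball (- c / a)%R (e / `|a|)%R).
  rewrite lebesgue_measure_ball; last by rewrite divr_ge0 ?ltW.
  by rewrite -[(_ *+ 2)%R]mulr_natl mulrA.
have E x : (`|a * x + c| = `|- c / a - x| * `|a|)%R.
  by rewrite -normrM -normrN; congr (`|_|)%R; field.
by apply/seteqP; split=> x; rewrite /ball /= /ball_ /= ltr_pdivlMr// E.
Qed.

Definition cube_slab n (z : n.-tuple R) (c e : R) : set (n.-tuple R) :=
  unit_cube n `&` [set x | (`|dotp z x + c| < e)%R].

Lemma measurable_cube_slab n (z : n.-tuple R) c e : measurable (cube_slab z c e).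
Proof.
apply: measurableI; first exact: measurable_unit_cube.
apply: measurable_set_normr_lt; apply: measurable_funD => //.
exact: measurable_dotp.
Qed.

(** Along coordinate [i], whatever the other coordinates are, the slab is an
    interval of length [2 * e / `|tnth z i|]; the other [n - 1] coordinates
    range over intervals of length 2. *)
Lemma cube_slab_le n (z : n.-tuple R) (c e : R) i : (0 < e)%R ->
  tnth z i != 0%R ->
  lebesgue_tuple R n (cube_slab z c e) <= (2 ^+ n * e / `|tnth z i|)%:E.
Proof.
move=> e0; elim: n z c i => [|n IH] z c i zi; first by case: i {zi}.
have zi1 : (0 < `|tnth z i|)%R by rewrite normr_gt0.
have mS := measurable_cube_slab z c e.
have cubeE a t : unit_cube n.+1 (tuple_cons (a, t)) <->
    `[(-1)%R, 1%R]%classic a /\ unit_cube n t.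
  split=> [H|[Ha Ht] j].
    by split=> [|j]; [exact: (H ord0)|rewrite -(tnthS a); exact: H].
  by case: (unliftP ord0 j) => [k ->|->//]; rewrite tnthS.
case: (unliftP ord0 i) => [j ij|i0].
- rewrite lebesgue_tuple_head//.
  apply: (@le_trans _ _ (\int[lebesgue_measure]_(a in `[(-1)%R, 1%R])
      (2 ^+ n * e / `|tnth z i|)%:E)).
    rewrite [leRHS]integral_mkcond; apply: le_integral_ge0 => a; first exact: measure_ge0.
    rewrite patchE; case: ifPn; [rewrite inE|rewrite notin_setE] => ha.
      have := IH [tuple of behead z] (thead z * a + c)%R j.
      rewrite tnth_behead_lift -ij => /(_ zi); apply: le_trans.
      apply: le_measure; rewrite ?inE.
      + rewrite -[X in measurable X]setTI.
        by apply: (measurableT_comp (measurable_tuple_cons (n := n)) (pair1_measurable a)).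
      + exact: measurable_cube_slab.
      + move=> t [/cubeE[_ ht]]; rewrite /= dotp_cons => h; split => //=.
        by rewrite addrCA addrA.
    rewrite (_ : [set t | _] = set0) ?measure0//.
    by apply/seteqP; split=> t //= -[/cubeE[]].
  rewrite integral_cst; last exact: measurable_itv.
  rewrite (_ : _ `[(-1)%R, 1%R]%classic = 2%:E); last exact: lebesgue_itvN11.
  by rewrite -EFinM lee_fin exprS le_eqVlt; apply/orP/or_introl/eqP; ring.
- rewrite lebesgue_tuple_behead//.
  apply: (@le_trans _ _ (\int[lebesgue_tuple R n]_(t in unit_cube n)
      (2 * e / `|tnth z i|)%:E)).
    rewrite [leRHS]integral_mkcond; apply: le_integral_ge0 => t; first exact: measure_ge0.
    rewrite patchE; case: ifPn; [rewrite inE|rewrite notin_setE] => ht.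
      rewrite -(affine_slab (dotp [tuple of behead z] t + c)%R zi e0).
      apply: le_measure; rewrite ?inE.
      + rewrite -[X in measurable X]setTI.
        by apply: (measurableT_comp (measurable_tuple_cons (n := n)) (pair2_measurable t)).
      + by apply: measurable_set_normr_lt; apply: measurable_funD.
      + move=> a [_]; rewrite /= dotp_cons i0 => h.
        by rewrite addrA.
    rewrite (_ : [set t | _] = set0) ?measure0//.
    by apply/seteqP; split=> a //= -[/cubeE[]].
  rewrite integral_cst; last exact: measurable_unit_cube.
  rewrite (_ : _ (unit_cube n) = (2 ^+ n)%:E); last exact: lebesgue_unit_cube.
  rewrite -EFinM lee_fin exprS le_eqVlt.
  by apply/orP/or_introl/eqP; ring.
Qed.

(** The induction of [cube_slab_le] again: as a function of coordinate [i]
    alone, the scalar product is affine and not constant. *)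
Lemma lebesgue_null_dotp n (z : n.-tuple R) i (N : set (measurableTypeR R)) :
  tnth z i != 0%R -> measurable N -> lebesgue_measure N = 0 ->
  lebesgue_tuple R n (dotp z @^-1` N) = 0.
Proof.
suff H : forall c, tnth z i != 0%R -> measurable N -> lebesgue_measure N = 0 ->
    lebesgue_tuple R n ((fun x => dotp z x + c)%R @^-1` N) = 0.
  move=> zi mN N0; rewrite -(H 0%R zi mN N0); congr (lebesgue_tuple R n _).
  by apply/seteqP; split=> x /=; rewrite addr0.
elim: n z i => [|n IH] z i c zi mN N0; first by case: i {zi}.
have mz : measurable ((fun x => dotp z x + c)%R @^-1` N).
  rewrite -[X in measurable X]setTI.
  by apply: measurable_funD => //; exact: measurable_dotp.
case: (unliftP ord0 i) => [j ij|i0].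
  rewrite lebesgue_tuple_head//; apply: integral0_eq => a _.
  rewrite -[RHS](IH [tuple of behead z] j (thead z * a + c)%R) ?tnth_behead_lift -?ij//.
  congr (lebesgue_tuple R n _).
  by apply/seteqP; split=> t /=; rewrite dotp_cons addrCA addrA.
rewrite lebesgue_tuple_behead//; apply: integral0_eq => t _.
rewrite -[RHS](affine_null (dotp [tuple of behead z] t + c) zi mN N0).
congr (lebesgue_measure _); apply/seteqP; split=> a /=.
  by rewrite dotp_cons i0 addrA.
by rewrite dotp_cons i0 addrA.
Qed.

End hyperplanes.

(** * Bands on the sphere *)

Section sphere_slab.
Context {R : realType} (n : nat).
Implicit Types x z w : n.-tuple R.

Lemma enorm_ge0 x : 0 <= enorm x. Proof. exact: sqrtr_ge0. Qed.

Lemma sqr_enorm x : enorm x ^+ 2 = dotp x x.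
Proof. by rewrite sqr_sqrtr// dotp_ge0. Qed.

(** Otherwise every coordinate would be smaller than [enorm z / n], and the sum
    of [n] such squares could not reach the square of [enorm z]. *)
Lemma enorm_le_coord z : 0 < enorm z ->
  exists i, enorm z <= n%:R * `|tnth z i|.
Proof.
move=> z0; apply/not_existsP => H.
have H' i : (n%:R * `|tnth z i|) ^+ 2 < enorm z ^+ 2.
  by rewrite ltr_pXn2r ?nnegrE ?mulr_ge0 ?enorm_ge0// ltNge; exact/negP.
have n0 : (0 < n)%N.
  rewrite lt0n; apply/eqP => n0; move: z0; rewrite /enorm /dotp.
  by rewrite big1 ?sqrtr0 ?ltxx// => i _; move: (ltn_ord i); rewrite {2}n0.
have : n%:R ^+ 2 * enorm z ^+ 2 < n%:R * enorm z ^+ 2.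
  have -> : n%:R * enorm z ^+ 2 = \sum_(i < n) enorm z ^+ 2.
    by rewrite sumr_const card_ord mulr_natl.
  rewrite {1}sqr_enorm mulr_sumr; apply: ltr_sum => [|i _].
    by apply/hasP; exists (Ordinal n0); rewrite ?mem_index_enum.
  by apply: le_lt_trans (H' i); rewrite exprMn real_normK ?num_real// -expr2.
rewrite ltr_pM2r ?exprn_gt0// expr2 gtr_pMr ?ltr0n//.
by rewrite ltNge ler1n n0.
Qed.

(** The surface measure is the volume of a cone in the unit ball.  Shrinking a
    unit vector [w] to a point [x] of the ball decreases [`|dotp z w|], so
    the cone over the band lies in a slab of the cube; its width is measured
    along the largest coordinate of [z]. *)
Lemma sphere_slab_le z (e : R) : 0 < e -> 0 < enorm z ->
  (sphere_measure R n [set w | `|dotp z w| < e]%R <=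
   (n%:R ^+ 2 * 2 ^+ n * e / enorm z)%:E)%E.
Proof.
move=> e0 z0; have [i zi] := enorm_le_coord z0.
have zi0 : 0 < `|tnth z i|.
  rewrite lt_neqAle normr_ge0 andbT eq_sym; apply/eqP => h.
  by move: (lt_le_trans z0 zi); rewrite h mulr0 ltxx.
have zi1 : tnth z i != 0 by rewrite -normr_gt0.
apply: (@le_trans _ _ (n%:R%:E * lebesgue_tuple R n (cube_slab z 0 e))%E).
  apply: lee_wpmul2l; first by rewrite lee_fin.
  apply: le_measure; rewrite ?inE.
  - apply: measurableI; last exact: measurable_punctured_ball.
    rewrite -[X in measurable X]setTI; apply: measurable_direction => //.
    exact: measurable_set_normr_lt (measurable_dotp z).
  - exact: measurable_cube_slab.
  - move=> x [/= h /andP[x0 x1]]; split.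
      by move=> j; rewrite /= in_itv/= -ler_norml (le_trans (tnth_le_enorm x j)).
    rewrite /= addr0; apply: le_lt_trans h.
    have -> : dotp z (direction x) = dotp z x / enorm x.
      rewrite /dotp mulr_suml; apply: eq_bigr => j _.
      by rewrite tnth_mktuple mulrA.
    rewrite normrM [`|_^-1|]gtr0_norm ?invr_gt0//.
    by rewrite ler_peMr// invf_ge1.
apply: (@le_trans _ _ (n%:R%:E * (2 ^+ n * e / `|tnth z i|)%:E)%E).
  by apply: lee_wpmul2l; [rewrite lee_fin|exact: cube_slab_le].
rewrite -EFinM lee_fin expr2 -!mulrA ler_wpM2l//.
rewrite [leRHS]mulrCA ler_wpM2l ?exprn_ge0// [leRHS]mulrCA ler_wpM2l ?(ltW e0)//.
by rewrite ler_pdivlMr// mulrC ler_pdivrMr.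
Qed.

End sphere_slab.

(** * The bilinear bound behind the Radon transform *)

Section radon_pairing.
Context {R : realType} (n : nat).
Hypothesis n0 : (0 < n)%N.
Local Notation T := (n.-tuple R).
Local Notation leb := (lebesgue_tuple R n).
Local Notation S := (sphere_measure R n).
Local Open Scope ereal_scope.

Definition tdiff (x y : T) : T := [tuple (tnth x i - tnth y i)%R | i < n].

(** The kernel [1 / |x - y|], with value [+oo] on the diagonal so that
    [integral_win_sphere] holds there as well. *)
Definition newton (x y : T) : \bar R := (enorm (tdiff x y))%:E^-1.

Lemma newton_ge0 x y : 0 <= newton x y.
Proof. by rewrite inve_ge0 lee_fin enorm_ge0. Qed.

Lemma measurable_tdiff : measurable_fun [set: T * T] (fun p => tdiff p.1 p.2).
Proof.
apply/measurable_fun_tnthP => i.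
rewrite (_ : _ \o _ = fun p : T * T => tnth p.1 i - tnth p.2 i)%R; last first.
  by apply/funext => p /=; rewrite tnth_mktuple.
by apply: measurable_funB; apply: (measurableT_comp (measurable_tnth i)).
Qed.

Lemma measurable_newton : measurable_fun [set: T * T] (fun p => newton p.1 p.2).
Proof.
have md : measurable_fun [set: T * T] (fun p => enorm (tdiff p.1 p.2)).
  exact: (measurableT_comp (@measurable_enorm R n) measurable_tdiff).
rewrite (_ : (fun p => _) = fun p => if enorm (tdiff p.1 p.2) == 0%R then +oo
    else (powR (enorm (tdiff p.1 p.2)) (-1))%:E).
  apply: measurable_fun_ifT => //.
    by apply: measurable_fun_eqr => //.
  apply/measurable_EFinP.
  apply: (@measurableT_comp _ _ _ _ _ _ (@powR R ^~ (-1)%R)) => //.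
apply/funext => p; rewrite /newton inver; case: ifP => // _.
by rewrite powR_inv1// enorm_ge0.
Qed.

Lemma measurable_dotp2 : measurable_fun [set: T * T] (fun p => dotp p.1 p.2).
Proof.
apply: measurable_sum => i; apply: measurable_funM.
  by apply: (measurableT_comp (measurable_tnth i)).
by apply: (measurableT_comp (measurable_tnth i)).
Qed.

Lemma dotp_tdiff (x y w : T) : dotp (tdiff x y) w = (dotp x w - dotp y w)%R.
Proof.
rewrite /dotp -sumrB; apply: eq_bigr => i _.
by rewrite tnth_mktuple mulrBl.
Qed.

Lemma dotpC (x y : T) : dotp x y = dotp y x.
Proof. by apply: eq_bigr => i _; rewrite mulrC. Qed.

(** The average over all directions of the approximate delta function
    [win e / (2 * e)] at [dotp (x - y) w] is dominated by [1 / |x - y|].  This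
    inequality plays the part of the identity which says that the Radon
    transform followed by its adjoint is a convolution with a multiple of
    [1 / |x|]. *)
Lemma integral_win_sphere (x y : T) (e : R) : (0 < e)%R ->
  \int[S]_w (win e (dotp x w - dotp y w))%:E <=
  (n%:R ^+ 2 * 2 ^+ n * e)%:E * newton x y.
Proof.
move=> e0.
have -> : \int[S]_w (win e (dotp x w - dotp y w))%:E =
    S [set w | (`|dotp (tdiff x y) w| < e)%R].
  rewrite -[RHS]mul1e -[RHS]integral_cst; last first.
    exact: measurable_set_normr_lt (measurable_dotp _).
  rewrite [RHS]integral_mkcond; apply: eq_integral => w _.
  rewrite patchE /win -dotp_tdiff.
  by case: ifPn => [|]; [rewrite inE => /= ->|rewrite notin_setE => /= /negP/negbTE ->].
have [d0|d0] := eqVneq (enorm (tdiff x y)) 0%R.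
  rewrite /newton d0 inve0 gt0_muley ?leey// lte_fin.
  by rewrite !mulr_gt0 ?exprn_gt0// ltr0n.
have d1 : (0 < enorm (tdiff x y))%R by rewrite lt_neqAle eq_sym d0 enorm_ge0.
by apply: (le_trans (sphere_slab_le e0 d1)); rewrite /newton inver (negbTE d0).
Qed.

Lemma newtonC (x y : T) : newton x y = newton y x.
Proof.
rewrite /newton /enorm; congr ((Num.sqrt _)%:E^-1); apply: eq_bigr => i _.
by rewrite !tnth_mktuple; ring.
Qed.

Definition newton_form (v w : T -> R) : \bar R :=
  \int[leb]_x ((v x)%:E * \int[leb]_y ((w y)%:E * newton x y)).

Definition newton_energy (f : T -> R) : \bar R := newton_form f f.

Definition radon_const : R := n%:R ^+ 2 * 2 ^+ n.

Section fixed_density.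
Variable f : T -> R.
Hypotheses (mf : measurable_fun setT f) (f0 : forall x, (0 <= f x)%R).

Let F e (p : T * T * T) : \bar R :=
  (f p.1.2 * (f p.2 * win e (dotp p.2 p.1.1 - dotp p.1.2 p.1.1)))%:E.

Let F0 e p : 0 <= F e p.
Proof. by rewrite lee_fin !mulr_ge0// win_ge0. Qed.

Let mF e : measurable_fun setT (F e).
Proof.
apply/measurable_EFinP; apply: measurable_funM.
  by apply: (measurableT_comp mf); apply: (measurableT_comp measurable_snd).
apply: measurable_funM; first exact: (measurableT_comp mf).
apply: (measurableT_comp (measurable_win e)); apply: measurable_funB.
  apply: (measurableT_comp measurable_dotp2 (g := fun p : T * T * T => (p.2, p.1.1))).
  by apply: measurable_fun_pair => //; exact: (measurableT_comp measurable_fst).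
apply: (measurableT_comp measurable_dotp2 (g := fun p : T * T * T => (p.1.2, p.1.1))).
apply: measurable_fun_pair => //.
  exact: (measurableT_comp measurable_snd).
exact: (measurableT_comp measurable_fst).
Qed.

Let A e (q : T * T) := \int[leb]_y F e (q, y).

Let mA e : measurable_fun setT (A e).
Proof. by apply: (@measurable_fun_fubini_tonelli_F _ _ _ _ R leb (F e)). Qed.

Let A0 e q : 0 <= A e q.
Proof. by apply: integral_ge0 => y _. Qed.

Let AE e w x : A e (w, x) = (f x)%:E * slab_mass leb ((@dotp R n)^~ w) f e (dotp x w).
Proof.
rewrite /slab_mass -ge0_integralZl//.
- apply/measurable_EFinP; apply: measurable_funM => //.
  apply: (measurableT_comp (measurable_win e)); apply: measurable_funB => //.
  exact: (measurableT_comp measurable_dotp2 (pair2_measurable w)).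
- by move=> y _; rewrite lee_fin mulr_ge0// win_ge0.
- by rewrite lee_fin.
Qed.

Lemma slab_energyE w e : slab_energy leb ((@dotp R n)^~ w) f e =
  (2 * e)^-1%:E * \int[leb]_x A (2 * e) (w, x).
Proof. by congr (_ * _); apply: eq_integral => x _; rewrite AE. Qed.

Lemma measurable_slab_energy e :
  measurable_fun setT (fun w => slab_energy leb ((@dotp R n)^~ w) f e).
Proof.
under eq_fun do rewrite slab_energyE.
by apply: measurable_funeM; apply: (@measurable_fun_fubini_tonelli_F _ _ _ _ R leb (A _)).
Qed.

Lemma slab_energy_ge0 w e : (0 < e)%R -> 0 <= slab_energy leb ((@dotp R n)^~ w) f e.
Proof.
move=> e0; rewrite slab_energyE mule_ge0//.
  by rewrite lee_fin invr_ge0 mulr_ge0 ?ltW.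
by apply: integral_ge0.
Qed.

(** Tonelli's theorem brings the integral over the directions inside, where
    [integral_win_sphere] applies; the factor [2 * e] of the latter cancels
    the normalisation of [slab_energy]. *)
Lemma integral_slab_energy e : (0 < e)%R ->
  \int[S]_w slab_energy leb ((@dotp R n)^~ w) f e <= radon_const%:E * newton_energy f.
Proof.
move=> e0; have e2 : (0 < 2 * e)%R by rewrite mulr_gt0.
under eq_integral do rewrite slab_energyE.
rewrite ge0_integralZl//; last 3 first.
- by apply: (@measurable_fun_fubini_tonelli_F _ _ _ _ R leb (A _)).
- by move=> w _; apply: integral_ge0.
- by rewrite lee_fin invr_ge0 ltW.
rewrite (@fubini_tonelli _ _ _ _ _ S leb (A (2 * e)))//.
rewrite muleC lee_pdivrMr//.
have mN : measurable_fun setT (fun p : T * T => (f p.2)%:E * newton p.1 p.2).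
  apply: emeasurable_funM; last exact: measurable_newton.
  by apply/measurable_EFinP; exact: (measurableT_comp mf).
have mI : measurable_fun setT (fun x => \int[leb]_y ((f y)%:E * newton x y)).
  apply: (@measurable_fun_fubini_tonelli_F _ _ _ _ R leb _ mN).
  by move=> p; rewrite mule_ge0 ?newton_ge0// lee_fin.
have I0 x : 0 <= \int[leb]_y ((f y)%:E * newton x y).
  by apply: integral_ge0 => y _; rewrite mule_ge0 ?newton_ge0// lee_fin.
have c0 : (0 <= radon_const * (2 * e))%R.
  by rewrite !mulr_ge0 ?exprn_ge0 ?(ltW e0)// ltW.
rewrite muleAC -EFinM /newton_energy /newton_form -ge0_integralZl//; last 2 first.
- by apply: emeasurable_funM => //; exact/measurable_EFinP.
- by move=> x _; rewrite mule_ge0// lee_fin.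
apply: le_integral_ge0 => x; first exact: integral_ge0.
have -> : \int[S]_w A (2 * e) (w, x) = \int[leb]_y \int[S]_w F (2 * e) (w, x, y).
  pose Fx (p : T * T) := F (2 * e) (p.1, x, p.2).
  apply: (@fubini_tonelli _ _ _ _ _ S leb Fx) => //.
    apply: (measurableT_comp (mF (2 * e)) (g := fun p : T * T => (p.1, x, p.2))).
    by apply: measurable_fun_pair => //; apply: measurable_fun_pair.
  by move=> p; exact: F0.
rewrite muleA -EFinM -ge0_integralZl//; last 3 first.
- exact: (measurableT_comp mN (pair1_measurable x)).
- by move=> y _; rewrite mule_ge0 ?newton_ge0// lee_fin.
- by rewrite lee_fin mulr_ge0.
apply: le_integral_ge0 => y; first by apply: integral_ge0 => w _; exact: F0.
have -> : \int[S]_w F (2 * e) (w, x, y) =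
    (f x * f y)%:E * \int[S]_w (win (2 * e) (dotp y w - dotp x w))%:E.
  rewrite -ge0_integralZl//.
  - by apply: eq_integral => w _; rewrite /F -EFinM mulrA.
  - apply/measurable_EFinP/(measurableT_comp (measurable_win _)).
    by apply: measurable_funB; exact: measurable_dotp.
  - by move=> w _; rewrite lee_fin win_ge0.
  - by rewrite lee_fin mulr_ge0.
apply: (le_trans (lee_wpmul2l _ (integral_win_sphere y x e2))).
  by rewrite lee_fin mulr_ge0.
rewrite (newtonC y x) !muleA -!EFinM /radon_const lee_wpmul2r ?newton_ge0//.
by rewrite lee_fin le_eqVlt; apply/orP/or_introl/eqP; ring.
Qed.

End fixed_density.

Section radon_transform.
Variable f : T -> R.
Hypotheses (mf : measurable_fun setT f) (f0 : forall x, (0 <= f x)%R).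

Let measurable_slice (G : R * T -> R) (x : T) : measurable_fun setT G ->
  measurable_fun setT (fun w => G (dotp x w, w)).
Proof.
move=> mG; apply: (measurableT_comp mG (g := fun w : T => (dotp x w, w))).
by apply: measurable_fun_pair => //; exact: measurable_dotp.
Qed.

Let measurable_incidence (G : R * T -> R) : measurable_fun setT G ->
  measurable_fun setT (fun p : T * T => G (dotp p.1 p.2, p.2)).
Proof.
move=> mG.
apply: (measurableT_comp mG (g := fun p : T * T => (dotp p.1 p.2, p.2))).
by apply: measurable_fun_pair => //; exact: measurable_dotp2.
Qed.

(** For each unit vector [w], [pairing_le_liminf] applies to the scalar
    product with [w]; a second use of Fatou's lemma integrates it in [w]. *)
Lemma radon_pairing_bounded (G : R * T -> R) (M l : R) :
  measurable_fun setT G -> (forall p, 0 <= G p <= M)%R -> (0 < l)%R ->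
  \int[leb]_x ((f x)%:E * \int[S]_w (G (dotp x w, w))%:E) <=
  l%:E * \int[lebesgue_measure \x S]_p (G p ^+ 2)%:E +
  (l^-1 * radon_const)%:E * newton_energy f.
Proof.
move=> mG GM l0; have G0 p : (0 <= G p)%R by have /andP[] := GM p.
pose F (p : T * T) := (f p.1 * G (dotp p.1 p.2, p.2))%:E.
have F0 p : 0 <= F p by rewrite lee_fin mulr_ge0.
have mF : measurable_fun setT F.
  apply/measurable_EFinP; apply: measurable_funM; last exact: measurable_incidence.
  exact: (measurableT_comp mf).
have -> : \int[leb]_x ((f x)%:E * \int[S]_w (G (dotp x w, w))%:E) =
    \int[leb]_x \int[S]_w F (x, w).
  apply: eq_integral => x _; rewrite -ge0_integralZl//.
  - by apply/measurable_EFinP; exact: measurable_slice.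
  - by move=> w _; rewrite lee_fin.
  - by rewrite lee_fin.
rewrite (@fubini_tonelli _ _ _ _ _ leb S F)//.
have mG2 : measurable_fun setT (fun p => (G p ^+ 2)%:E).
  exact/measurable_EFinP/measurable_funX.
pose N2 w := \int[lebesgue_measure]_t (G (t, w) ^+ 2)%:E.
have N20 w : 0 <= N2 w by apply: integral_ge0 => t _; rewrite lee_fin sqr_ge0.
have mN2 : measurable_fun setT N2.
  apply: (@measurable_fun_fubini_tonelli_G _ _ _ _ R lebesgue_measure _ mG2).
  by move=> p; rewrite lee_fin sqr_ge0.
pose r k w := l%:E * N2 w + l^-1%:E * slab_energy leb ((@dotp R n)^~ w) f k.+1%:R^-1.
have k0 k : (0 < k.+1%:R^-1 :> R)%R by rewrite invr_gt0.
have l1 : (0 <= l)%R := ltW l0.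
have l2 : (0 <= l^-1)%R by rewrite invr_ge0.
have r0 k w : 0 <= r k w.
  by rewrite adde_ge0// mule_ge0 ?slab_energy_ge0 ?N20// lee_fin.
have mr k : measurable_fun setT (r k).
  apply: emeasurable_funD; apply: measurable_funeM => //.
  exact: measurable_slab_energy.
apply: (@le_trans _ _ (\int[S]_w limn_einf (r^~ w))).
  apply: ae_ge0_le_integral => //.
  - by move=> w _; apply: integral_ge0.
  - exact: (@measurable_fun_fubini_tonelli_G _ _ _ _ R leb F).
  - by move=> w _; rewrite -(limn_einf_cst 0); exact: le_limn_einf.
  - exact: measurable_fun_limn_einf.
  (* the surface measure does not charge the complement of the sphere *)
  exists (~` sphere n); split.
  - by apply: measurableC; exact: measurable_sphere.
  - exact: sphere_measure_setC.
  - move=> w /= nw; rewrite /sphere/= => w1; apply: nw => _.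
    have mdw : measurable_fun setT ((@dotp R n)^~ w).
      exact: (measurableT_comp measurable_dotp2 (pair2_measurable w)).
    have [i wi] : exists i, tnth w i != 0%R.
      apply/not_existsP => H; move: w1; rewrite /enorm /dotp big1 ?sqrtr0.
        by move/eqP; rewrite eq_sym oner_eq0.
      by move=> i _; move: (H i) => /negP; rewrite negbK => /eqP ->; rewrite mul0r.
    apply: (@pairing_le_liminf _ _ _ leb _ f mdw mf f0 _ (fun t => G (t, w)) M) => //.
    + move=> N mN N0; rewrite -(lebesgue_null_dotp wi mN N0); congr (leb _).
      by apply/seteqP; split=> x /=; rewrite dotpC.
    + exact: (measurableT_comp mG (pair2_measurable w)).
apply: (le_trans (fatou S measurableT mr _)) => //.
rewrite -[leRHS]limn_einf_cst; apply: le_limn_einf => k.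
rewrite ge0_integralD//; last 4 first.
- by move=> w _; rewrite mule_ge0// lee_fin.
- exact: measurable_funeM.
- by move=> w _; rewrite mule_ge0 ?slab_energy_ge0// lee_fin.
- by apply: measurable_funeM; exact: measurable_slab_energy.
apply: leeD.
  rewrite ge0_integralZl// (@fubini_tonelli2 _ _ _ _ R lebesgue_measure S _ mG2)//.
  by move=> p; rewrite lee_fin sqr_ge0.
rewrite ge0_integralZl//; last 2 first.
- exact: measurable_slab_energy.
- by move=> w _; rewrite slab_energy_ge0.
by rewrite EFinM -muleA lee_wpmul2l ?lee_fin//; exact: integral_slab_energy.
Qed.

(** Truncating [G] at height [k] reduces to [radon_pairing_bounded], and
    monotone convergence removes the truncation. *)
Lemma radon_pairing_le (G : R * T -> R) (l : R) :
  measurable_fun setT G -> (forall p, 0 <= G p)%R -> (0 < l)%R ->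
  \int[leb]_x ((f x)%:E * \int[S]_w (G (dotp x w, w))%:E) <=
  l%:E * \int[lebesgue_measure \x S]_p (G p ^+ 2)%:E +
  (l^-1 * radon_const)%:E * newton_energy f.
Proof.
move=> mG G0 l0.
pose Gk k p := Num.min (G p) k%:R.
have mGk k : measurable_fun setT (Gk k) by exact: measurable_minr.
have Gk0 k p : (0 <= Gk k p <= k%:R)%R.
  by rewrite /Gk le_min G0 ler0n ge_min lexx orbT.
have Gk1 k p : (0 <= Gk k p)%R by have /andP[] := Gk0 k p.
have cvgGk p : (Gk k p)%:E @[k --> \oo] --> (G p)%:E.
  apply: cvg_near_cst; near=> k; rewrite /Gk min_l//.
  by near: k; exact: nbhs_infty_ger.
have ndGk p : {homo Gk^~ p : i j / (i <= j)%N >-> (i <= j)%R}.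
  by move=> i j ij; rewrite /Gk le_min !ge_min lexx/= ler_nat ij orbT.
pose u k x := \int[S]_w (Gk k (dotp x w, w))%:E.
have u0 k x : 0 <= u k x by apply: integral_ge0 => w _; rewrite lee_fin.
have mu_ k : measurable_fun setT (u k).
  pose F (p : T * T) := (Gk k (dotp p.1 p.2, p.2))%:E.
  apply: (@measurable_fun_fubini_tonelli_F _ _ _ _ R S F).
    by apply/measurable_EFinP; exact: measurable_incidence.
  by move=> p; rewrite lee_fin.
have ndu x : nondecreasing_seq (u^~ x).
  by move=> i j ij; apply: le_integral_ge0 => w; rewrite lee_fin//; exact: ndGk.
have limu x : limn (u^~ x) = \int[S]_w (G (dotp x w, w))%:E.
  rewrite -monotone_convergence//.
  - by apply: eq_integral => w _; apply/cvg_lim => //; exact: cvgGk.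
  - by move=> k; apply/measurable_EFinP; exact: measurable_slice.
  - by move=> k w _; rewrite lee_fin.
  - by move=> w _ i j ij; rewrite lee_fin; exact: ndGk.
have -> : \int[leb]_x ((f x)%:E * \int[S]_w (G (dotp x w, w))%:E) =
    limn (fun k => \int[leb]_x ((f x)%:E * u k x)).
  rewrite -monotone_convergence//.
  - apply: eq_integral => x _; rewrite -limu; apply/esym/cvg_lim => //.
    by apply: cvgeZl => //; exact: ereal_nondecreasing_is_cvgn.
  - by move=> k; apply: emeasurable_funM => //; exact/measurable_EFinP.
  - by move=> k x _; rewrite mule_ge0// lee_fin.
  - by move=> x _ i j ij; rewrite lee_wpmul2l ?lee_fin//; exact: ndu.
apply: lime_le.
  apply: ereal_nondecreasing_is_cvgn => i j ij.
  apply: le_integral_ge0 => x; first by rewrite mule_ge0// lee_fin.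
  by rewrite lee_wpmul2l ?lee_fin//; exact: ndu.
apply: nearW => k; apply: (le_trans (radon_pairing_bounded (mGk k) (Gk0 k) l0)).
rewrite leeD2r// lee_wpmul2l ?lee_fin ?(ltW l0)//.
apply: le_integral_ge0 => p; rewrite lee_fin ?sqr_ge0//.
by rewrite lerXn2r ?nnegrE// /Gk ge_min lexx.
Unshelve. all: by end_near. Qed.

End radon_transform.

End radon_pairing.

(** * Potentials of functions of bounded height *)

Section weak_hoelder.
Context d (T : measurableType d) (R : realType).
Variable mu : {measure set T -> \bar R}.
Local Open Scope ereal_scope.

(** Hoelder's inequality on a set, up to the factor 2: pointwise,
    [w ^+ k <= B ^- k + B * w ^+ k.+1], by distinguishing whether [w] is below
    or above [1 / B]. *)
Lemma integral_expr_le (k : nat) (w : T -> R) (E : set T) (B : R) :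
  measurable_fun setT w -> (forall x, 0 <= w x)%R -> measurable E ->
  \int[mu]_x (w x ^+ k.+1)%:E <= 1 -> (0 < B)%R ->
  mu E <= (B ^+ k.+1)%:E ->
  \int[mu]_(x in E) (w x ^+ k)%:E <= (2 * B)%:E.
Proof.
move=> mw w0 mE w1 B0 EB.
have mwk j : measurable_fun setT (fun x => (w x ^+ j)%:E).
  exact/measurable_EFinP/measurable_funX.
apply: (@le_trans _ _ (\int[mu]_(x in E) ((B^-1 ^+ k)%:E +
    B%:E * (w x ^+ k.+1)%:E))).
  apply: ge0_le_integral => //.
  - by move=> x _; rewrite lee_fin exprn_ge0.
  - exact: measurable_funTS.
  - apply: emeasurable_funD => //; apply: measurable_funeM.
    exact: measurable_funTS.
  move=> x _; rewrite -EFinM -EFinD lee_fin.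
  have [wB|Bw] := leP (w x) (B^-1)%R.
    rewrite -[leLHS]addr0 lerD//; last by rewrite mulr_ge0 ?exprn_ge0// ltW.
    by rewrite lerXn2r// nnegrE ?invr_ge0// ltW.
  rewrite -[leLHS]add0r lerD//; first by rewrite exprn_ge0 ?invr_ge0// ltW.
  rewrite exprS mulrA ler_peMl ?exprn_ge0//.
  by rewrite -(mulfV (lt0r_neq0 B0)) ler_wpM2l// ltW.
rewrite ge0_integralD//; last 3 first.
- by move=> x _; rewrite lee_fin exprn_ge0 ?invr_ge0// ltW.
- by move=> x _; rewrite -EFinM lee_fin mulr_ge0 ?exprn_ge0// ltW.
- by apply: measurable_funeM; exact: measurable_funTS.
rewrite integral_cst// ge0_integralZl//; last 3 first.
- exact: measurable_funTS.
- by move=> x _; rewrite lee_fin exprn_ge0.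
- by rewrite lee_fin ltW.
rewrite mulr_natl mulr2n EFinD; apply: leeD.
  apply: (@le_trans _ _ ((B^-1 ^+ k)%:E * (B ^+ k.+1)%:E)).
    by rewrite lee_wpmul2l// lee_fin exprn_ge0// invr_ge0 ltW.
  by rewrite -EFinM exprSr mulrA exprVn mulVf ?mul1r// expf_neq0// gt_eqF.
rewrite -[leRHS]mule1 lee_wpmul2l ?lee_fin ?(ltW B0)//.
apply: le_trans w1; apply: ge0_subset_integral => //.
by move=> x _; rewrite lee_fin exprn_ge0.
Qed.

Lemma le_integral_series (H : T -> \bar R) (g : nat -> T -> \bar R) (c : R) :
  (0 <= c)%R -> (forall x, 0 <= H x) -> (forall k x, 0 <= g k x) ->
  (forall k, measurable_fun setT (g k)) ->
  (forall x, H x <= \sum_(0 <= k <oo) g k x) ->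
  (forall k, \int[mu]_x g k x <= (c / (2 ^ k.+1)%:R)%:E) ->
  \int[mu]_x H x <= c%:E.
Proof.
move=> c0 H0 g0 mg Hg gc.
apply: le_trans (epsilon_trick0 xpredT c0).
apply: (le_trans (le_integral_ge0 mu H0 Hg)).
rewrite integral_nneseries//.
by apply: lee_nneseries => [k _ _|k _]; [exact: integral_ge0|exact: gc].
Qed.

End weak_hoelder.

(** [D] is located among the scales [4 ^- k * a ^- 2] if it is below [a ^- 2],
    and among the scales [4 ^+ k * a ^- 2] otherwise.  The ratio 4 makes the
    square roots of these radii powers of 2, up to the factor [1 / a]. *)
Lemma newton_scale (R : realType) (a D : R) : 0 < a -> 0 < D -> exists k : nat,
  D^-1 <= 4 ^+ k.+1 * a ^+ 2 * win (4^-1 ^+ k * a ^- 2) D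
        + 4^-1 ^+ k * a ^+ 2 * win (4 ^+ k.+1 * a ^- 2) D.
Proof.
move=> a0 D0; have a2 : 0 < a ^+ 2 by rewrite exprn_gt0.
have q k : 0 < 4 ^+ k :> R by rewrite exprn_gt0.
have qV k : 0 < 4^-1 ^+ k :> R by rewrite exprn_gt0 ?invr_gt0.
have big (M : R) : exists k : nat, M <= 4 ^+ k.+1.
  exists (Num.truncn M).+1; apply: le_trans (ltW (truncnS_gt M)) _.
  rewrite -natrX ler_nat; apply: leq_trans (ltnW (ltn_expl _ (isT : 1 < 4)%N)) _.
  by rewrite leq_exp2l.
have [Dr|rD] := ltP D (a ^- 2).
  have ex : exists k : nat, 4^-1 ^+ k.+1 * a ^- 2 <= D.
    have [k hk] := big (a ^- 2 / D); exists k.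
    rewrite exprVn ler_pdivrMl//.
    by rewrite -ler_pdivrMr.
  case: (ex_minnP ex) => k hk mink; exists k.
  rewrite -[leLHS]addr0 lerD//; last by rewrite !mulr_ge0 ?win_ge0// ltW.
  rewrite /win gtr0_norm// (_ : (D < _) = true) ?mulr1.
    rewrite -[leRHS]invrK lef_pV2 ?posrE ?invr_gt0 ?mulr_gt0//.
    by rewrite invfM -exprVn.
  case: k hk mink => [|k] hk mink; first by rewrite expr0 mul1r.
  by rewrite ltNge; apply/negP => /mink; rewrite ltnn.
have ex : exists k : nat, D < 4 ^+ k.+1 * a ^- 2.
  have [k hk] := big (D * a ^+ 2 + 1); exists k.
  by rewrite ltr_pdivlMr//; apply: lt_le_trans hk; rewrite ltrDl.
case: (ex_minnP ex) => k hk mink; exists k.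
rewrite -[leLHS]add0r lerD//; first by rewrite !mulr_ge0 ?win_ge0// ltW.
rewrite /win gtr0_norm// hk mulr1.
rewrite -[leRHS]invrK lef_pV2 ?posrE ?invr_gt0 ?mulr_gt0//.
rewrite invfM -exprVn invrK.
case: k hk mink => [|k] hk mink; first by rewrite expr0 mul1r.
by rewrite leNgt; apply/negP => /mink; rewrite ltnn.
Qed.

Section riesz_potential.
Context {R : realType} (n : nat).
Hypothesis n1 : (1 < n)%N.
Local Notation T := (n.-tuple R).
Local Notation leb := (lebesgue_tuple R n).
Local Open Scope ereal_scope.

Definition eball (x : T) (s : R) : set T := [set y | (enorm (tdiff x y) < s)%R].

Lemma measurable_edist (x : T) : measurable_fun setT (fun y => enorm (tdiff x y)).
Proof.
apply: (measurableT_comp (@measurable_enorm R n)).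
have -> : tdiff x = (fun p : T * T => tdiff p.1 p.2) \o (fun y => (x, y)) by [].
apply: measurableT_comp; first exact: measurable_tdiff.
exact: pair1_measurable.
Qed.

Lemma measurable_eball x s : measurable (eball x s).
Proof.
rewrite (_ : eball x s = [set y | (`|enorm (tdiff x y)| < s)%R]).
  by apply: measurable_set_normr_lt; exact: measurable_edist.
by apply/seteqP; split=> y; rewrite /eball /= ger0_norm// enorm_ge0.
Qed.

Lemma lebesgue_eball_le x s : (0 < s)%R -> leb (eball x s) <= ((2 * s) ^+ n)%:E.
Proof.
move=> s0; pose Q i : set R := ball (tnth x i) s.
have mQ i : measurable (Q i) by exact: measurable_ball.
apply: (@le_trans _ _ (leb [set y | forall i, Q i (tnth y i)])).
  apply: le_measure; rewrite ?inE.
  - exact: measurable_eball.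
  - exact: measurable_box.
  - move=> y /= h i; apply: le_lt_trans h.
    by have := tnth_le_enorm (tdiff x y) i; rewrite tnth_mktuple.
rewrite lebesgue_tuple_box// (eq_bigr (fun=> (2 * s)%:E)).
  by rewrite prodEFin prodr_const card_ord.
move=> i _; rewrite /Q; have := lebesgue_measure_ball (tnth x i) (ltW s0).
by rewrite -[(s *+ 2)%R]mulr_natl.
Qed.

Lemma integral_eball (h : T -> R) x s : (forall y, (0 <= h y)%R) ->
  \int[leb]_y (h y * win s (enorm (tdiff x y)))%:E =
  \int[leb]_(y in eball x s) (h y)%:E.
Proof.
move=> h0; rewrite [RHS]integral_mkcond; apply: eq_integral => y _.
rewrite patchE /win ger0_norm ?enorm_ge0//.
by case: ifPn; [rewrite inE /eball /= => ->; rewrite mulr1|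
  rewrite notin_setE /eball /= => /negP/negbTE ->; rewrite mulr0].
Qed.

Definition riesz_const : R := 8 * 2 ^+ n + 16.

Section truncated.
Variables (w : T -> R) (a : R) (x : T).
Hypotheses (mw : measurable_fun setT w) (w0 : forall y, (0 <= w y)%R).
Hypothesis w1 : \int[leb]_y (w y ^+ (2 * n))%:E <= 1.
Hypothesis a0 : (0 < a)%R.

(** The power [2 * n - 1] turns a function [w] in L^(2n) into a function in the
    dual space: for the conjugate exponent [p = 2n / (2n - 1)], the [p]-th
    power of [w ^+ (2 * n - 1)] is [w ^+ (2 * n)].  In this parametrisation all
    exponents are natural numbers. *)
Definition below (y : T) : R := if (w y <= a)%R then (w y ^+ (2 * n).-1)%R else 0%R.

Lemma below_ge0 y : (0 <= below y)%R.
Proof. by rewrite /below; case: ifP => // _; rewrite exprn_ge0. Qed.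

Lemma measurable_below : measurable_fun setT below.
Proof.
apply: measurable_fun_ifT => //; first exact: measurable_fun_ler.
exact: measurable_funX.
Qed.

(** Small scales: on a ball of radius at most [a ^- 2] the function [below] is
    bounded by the height [a ^+ (2 * n - 1)]. *)
Let term1 k : ((4 ^+ k.+1 * a ^+ 2)%:E *
   \int[leb]_(y in eball x (4^-1 ^+ k * a ^- 2)) (below y)%:E <=
   (4 * 2 ^+ n * a / (2 ^+ k))%:E)%E.
Proof.
have s0 : (0 < 4^-1 ^+ k * a ^- 2)%R by rewrite mulr_gt0 ?invr_gt0 ?exprn_gt0 ?invr_gt0.
have mE := measurable_eball x (4^-1 ^+ k * a ^- 2)%R.
have H : \int[leb]_(y in eball x (4^-1 ^+ k * a ^- 2)) (below y)%:E <=
    (a ^+ (2 * n).-1 * (2 * (4^-1 ^+ k * a ^- 2)) ^+ n)%:E.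
  apply: (@le_trans _ _ (\int[leb]_(y in eball x (4^-1 ^+ k * a ^- 2)) (a ^+ (2 * n).-1)%:E)).
    apply: ge0_le_integral => //.
    - by move=> y _; rewrite lee_fin below_ge0.
    - by apply/measurable_EFinP/measurable_funTS; exact: measurable_below.
    - move=> y _; rewrite lee_fin /below; case: ifP => [wa|_].
        by rewrite lerXn2r ?nnegrE// ltW.
      by rewrite exprn_ge0// ltW.
  rewrite integral_cst// EFinM lee_wpmul2l ?lebesgue_eball_le//.
  by rewrite lee_fin exprn_ge0// ltW.
apply: (le_trans (lee_wpmul2l _ H)).
  by rewrite lee_fin mulr_ge0 ?exprn_ge0// ltW.
rewrite -EFinM lee_fin.
have n2 : (0 < 2 * n)%N by rewrite muln_gt0 (ltnW n1).
have X0 : (0 < a ^+ (2 * n))%R by rewrite exprn_gt0.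
set q := (4^-1 ^+ k)%R; have q0 : (0 < q)%R by rewrite exprn_gt0// invr_gt0.
have -> : (4 ^+ k.+1 * a ^+ 2 * (a ^+ (2 * n).-1 * (2 * (q * a ^- 2)) ^+ n) =
  4 * 2 ^+ n * a * (4 ^+ k * q ^+ n))%R.
  have aa : (a ^+ (2 * n) = a * a ^+ (2 * n).-1)%R by rewrite -exprS prednK.
  have -> : ((2 * (q * a ^- 2)) ^+ n = 2 ^+ n * q ^+ n * (a * a ^+ (2 * n).-1)^-1)%R.
    rewrite -aa; move: (q) => q'.
    by rewrite mulrA 2!exprMn exprVn -exprM.
  rewrite exprS; field.
  by rewrite !expf_neq0 gt_eqF.
rewrite ler_wpM2l ?mulr_ge0 ?exprn_ge0 ?(ltW a0)//.
apply: (@le_trans _ _ (4 ^+ k * q ^+ 2)%R).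
  rewrite ler_wpM2l ?exprn_ge0// ler_wiXn2l ?(ltW q0)//.
  by rewrite /q; apply: exprn_ile1; rewrite ?invr_ge0// invf_le1// ler1n.
rewrite expr2 mulrA /q exprVn mulfV ?expf_neq0// mul1r.
by rewrite lef_pV2 ?posrE ?exprn_gt0// lerXn2r ?nnegrE// ler_nat.
Qed.

(** Large scales: outside the ball of radius [a ^- 2] the norm of [w] is used,
    through [integral_expr_le]. *)
Let term2 k : ((4^-1 ^+ k * a ^+ 2)%:E *
   \int[leb]_(y in eball x (4 ^+ k.+1 * a ^- 2)) (below y)%:E <=
   (8 * a / (2 ^+ k))%:E)%E.
Proof.
have n2 : (0 < 2 * n)%N by rewrite muln_gt0 (ltnW n1).
have s0 : (0 < 4 ^+ k.+1 * a ^- 2)%R by rewrite mulr_gt0 ?invr_gt0 ?exprn_gt0.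
have mE := measurable_eball x (4 ^+ k.+1 * a ^- 2)%R.
have H : \int[leb]_(y in eball x (4 ^+ k.+1 * a ^- 2)) (below y)%:E <=
    (2 * (2 * 2 ^+ k.+1 / a))%:E.
  apply: (@le_trans _ _ (\int[leb]_(y in eball x (4 ^+ k.+1 * a ^- 2)) (w y ^+ (2 * n).-1)%:E)).
    apply: ge0_le_integral => //.
    - by move=> y _; rewrite lee_fin below_ge0.
    - by apply/measurable_EFinP/measurable_funTS; exact: measurable_below.
    - by apply/measurable_EFinP/measurable_funTS; exact: measurable_funX.
    - move=> y _; rewrite lee_fin /below; case: ifP => [//|_].
      by rewrite exprn_ge0.
  apply: integral_expr_le => //.
  - by rewrite prednK.
  - by rewrite divr_gt0 ?mulr_gt0 ?exprn_gt0.
  - rewrite prednK//; apply: (le_trans (lebesgue_eball_le x s0)).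
    rewrite lee_fin exprM lerXn2r ?nnegrE ?sqr_ge0 ?mulr_ge0 ?(ltW s0)//.
      by rewrite invr_ge0 sqr_ge0.
    have -> : ((2 * 2 ^+ k.+1 / a) ^+ 2 = 4 * (4 ^+ k.+1 / a ^+ 2))%R.
      have -> : (4 ^+ k.+1 = 2 ^+ k.+1 * 2 ^+ k.+1 :> R)%R.
        by rewrite -exprMn; congr (_ ^+ _)%R; rewrite -natrM.
      by field; rewrite gt_eqF.
    by rewrite ler_wpM2r ?(ltW s0)// ler_nat.
apply: (le_trans (lee_wpmul2l _ H)).
  by rewrite lee_fin mulr_ge0 ?exprn_ge0 ?invr_ge0// ltW.
rewrite -EFinM lee_fin le_eqVlt; apply/orP/or_introl/eqP.
have -> : (4^-1 ^+ k = (2 ^+ k)^-1 * (2 ^+ k)^-1 :> R)%R.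
  rewrite -invfM -exprMn exprVn; congr ((_ ^+ _)^-1)%R.
  by rewrite -natrM.
rewrite [(2 ^+ k.+1)%R]exprS; field.
by rewrite expf_neq0// gt_eqF.
Qed.

(** The core of the Hardy-Littlewood-Sobolev inequality: cutting the kernel at
    the radius [a ^- 2], the height of [below] controls the inner part, the
    norm of [w] the outer part, and with this radius both are of order [a]. *)
Lemma riesz_below : \int[leb]_y ((below y)%:E * newton x y) <= (riesz_const * a)%:E.
Proof.
have n2 : (0 < n)%N by rewrite (ltnW n1).
pose c1 k : R := (4 ^+ k.+1 * a ^+ 2)%R.
pose c2 k : R := (4^-1 ^+ k * a ^+ 2)%R.
pose s1 k : R := (4^-1 ^+ k * a ^- 2)%R.
pose s2 k : R := (4 ^+ k.+1 * a ^- 2)%R.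
have c10 k : (0 < c1 k)%R by rewrite mulr_gt0 ?exprn_gt0.
have c20 k : (0 < c2 k)%R by rewrite mulr_gt0 ?exprn_gt0 ?invr_gt0.
pose D y := enorm (tdiff x y).
pose b (s : nat -> R) k y := (below y * win (s k) (D y))%:E.
pose g k y := (c1 k)%:E * b s1 k y + (c2 k)%:E * b s2 k y.
have b0 s k y : 0 <= b s k y by rewrite lee_fin mulr_ge0 ?below_ge0 ?win_ge0.
have mb s k : measurable_fun setT (b s k).
  apply/measurable_EFinP/measurable_funM; first exact: measurable_below.
  by apply: (measurableT_comp (measurable_win _)); exact: measurable_edist.
have g0 k y : 0 <= g k y.
  by rewrite adde_ge0// mule_ge0// lee_fin ltW.
apply: (@le_integral_series _ _ _ leb _ g).
- by rewrite mulr_ge0 ?(ltW a0)// addr_ge0// mulr_ge0 ?exprn_ge0.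
- by move=> y; rewrite mule_ge0 ?newton_ge0// lee_fin below_ge0.
- exact: g0.
- by move=> k; apply: emeasurable_funD; apply: measurable_funeM.
- move=> y; have term k : g k y <= \sum_(0 <= k <oo) g k y.
    apply: (@le_trans _ _ (\sum_(0 <= j < k.+1) g j y)).
      rewrite big_nat_recr//= leeDr//; exact: sume_ge0.
    exact: nneseries_lim_ge.
  have [D0|D0] := eqVneq (D y) 0%R; last first.
    have Dy : (0 < D y)%R by rewrite lt_neqAle eq_sym D0 enorm_ge0.
    have [k hk] := newton_scale a0 Dy; apply: le_trans (term k).
    rewrite /newton inver -/(D y) (negbTE D0) /g /b -!EFinM -EFinD lee_fin.
    apply: (le_trans (ler_wpM2l (below_ge0 y) hk)).
    by rewrite le_eqVlt; apply/orP/or_introl/eqP; rewrite /c1 /c2 /s1 /s2; ring.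
  have [h0|h0] := eqVneq (below y) 0%R.
    by rewrite h0 mul0e; apply: nneseries_ge0 => *; exact: g0.
  have hy : (0 < below y)%R by rewrite lt_neqAle eq_sym h0 below_ge0.
  (* on the diagonal the terms of the series are unbounded *)
  suff -> : \sum_(0 <= k <oo) g k y = +oo by exact: leey.
  apply/eqyP => r r0.
  have c : (0 < a ^+ 2 * below y)%R by rewrite mulr_gt0// exprn_gt0.
  pose k := (Num.truncn (r / (a ^+ 2 * below y))).+1.
  apply: le_trans (term k).
  rewrite -[leLHS]adde0 /g; apply: leeD; last by rewrite mule_ge0// lee_fin ltW.
  rewrite /b /win D0 normr0 mulr_gt0 ?exprn_gt0 ?invr_gt0 ?exprn_gt0// mulr1 -EFinM lee_fin.
  rewrite /c1 -mulrA -ler_pdivrMr//; apply: le_trans (ltW (truncnS_gt _)) _.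
  rewrite -natrX ler_nat -/k; apply: leq_trans (ltnW (ltn_expl _ (isT : 1 < 4)%N)) _.
  by rewrite leq_exp2l.
- move=> k; rewrite ge0_integralD//; last 4 first.
  + by move=> y _; rewrite mule_ge0// lee_fin ltW.
  + exact: measurable_funeM.
  + by move=> y _; rewrite mule_ge0// lee_fin ltW.
  + exact: measurable_funeM.
  rewrite !ge0_integralZl//; last 2 first.
  + by rewrite lee_fin ltW.
  + by rewrite lee_fin ltW.
  rewrite /b !integral_eball; [|exact: below_ge0|exact: below_ge0].
  apply: (le_trans (leeD (term1 k) (term2 k))).
  rewrite -EFinD lee_fin le_eqVlt; apply/orP/or_introl/eqP.
  rewrite natrX [(2 ^+ k.+1)%R]exprS /riesz_const; field.
  by rewrite expf_neq0.
Qed.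

End truncated.

(** * The Hardy-Littlewood-Sobolev inequality for the kernel 1 / |x - y| *)

Let m := (2 * n).-1.

Let mE : (2 * n = m.+1)%N.
Proof. by rewrite prednK// muln_gt0 (ltnW n1). Qed.

Let m0 : (0 < m)%N.
Proof. by rewrite -ltnS -mE; apply: (leq_trans n1); rewrite leq_pmull. Qed.

Lemma newton_potential_ge0 (w : T -> R) x : (forall y, 0 <= w y)%R ->
  0 <= \int[leb]_y ((w y)%:E * newton x y).
Proof.
by move=> w0; apply: integral_ge0 => y _; rewrite mule_ge0 ?newton_ge0// lee_fin.
Qed.

Lemma measurable_newton_integrand (w : T -> R) : measurable_fun setT w ->
  measurable_fun setT (fun p : T * T => (w p.2)%:E * newton p.1 p.2).
Proof.
move=> mw; apply: emeasurable_funM; last exact: measurable_newton.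
by apply/measurable_EFinP; exact: (measurableT_comp mw).
Qed.

Lemma measurable_newton_slice (w : T -> R) x : measurable_fun setT w ->
  measurable_fun setT (fun y : T => (w y)%:E * newton x y).
Proof.
move=> mw; exact: (measurableT_comp (measurable_newton_integrand mw) (pair1_measurable x)).
Qed.

Lemma measurable_newton_potential (w : T -> R) : measurable_fun setT w ->
  (forall y, 0 <= w y)%R ->
  measurable_fun setT (fun x => \int[leb]_y ((w y)%:E * newton x y)).
Proof.
move=> mw w0; apply: (@measurable_fun_fubini_tonelli_F _ _ _ _ R leb _
  (measurable_newton_integrand mw)).
by move=> p; rewrite mule_ge0 ?newton_ge0// lee_fin.
Qed.

Lemma newton_formC (f h : T -> R) : measurable_fun setT f -> measurable_fun setT h ->
  (forall x, 0 <= f x)%R -> (forall x, 0 <= h x)%R ->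
  newton_form f h = newton_form h f.
Proof.
move=> mf mh f0 h0.
pose F (p : T * T) := ((f p.1)%:E * ((h p.2)%:E * newton p.1 p.2))%E.
have F0 p : 0 <= F p by rewrite mule_ge0 ?mule_ge0 ?newton_ge0 ?lee_fin.
have mF : measurable_fun setT F.
  apply: emeasurable_funM; last exact: measurable_newton_integrand.
  by apply/measurable_EFinP; exact: (measurableT_comp mf).
transitivity (\int[leb]_x \int[leb]_y F (x, y)).
  apply: eq_integral => x _; rewrite -ge0_integralZl ?lee_fin//.
    exact: measurable_newton_slice.
  by move=> y _; rewrite mule_ge0 ?newton_ge0 ?lee_fin.
rewrite (@fubini_tonelli _ _ _ _ _ leb leb F)//.
apply: eq_integral => y _; rewrite -ge0_integralZl ?lee_fin//.
- by apply: eq_integral => x _; rewrite /F/= muleCA newtonC.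
- exact: measurable_newton_slice.
- by move=> x _; rewrite mule_ge0 ?newton_ge0 ?lee_fin.
Qed.

Let energy_below (v w : T -> R) : measurable_fun setT v -> measurable_fun setT w ->
  (forall y, 0 <= v y)%R -> (forall y, 0 <= w y)%R ->
  \int[leb]_y (v y ^+ (2 * n))%:E <= 1 ->
  \int[leb]_y (w y ^+ (2 * n))%:E <= 1 ->
  \int[leb]_x \int[leb]_y ((v x ^+ m)%:E * ((below w (v x) y)%:E * newton x y)) <=
  riesz_const%:E.
Proof.
move=> mv mw v0 w0 v1 w1.
have c0 : (0 <= riesz_const)%R by rewrite addr_ge0// mulr_ge0 ?exprn_ge0.
apply: (@le_trans _ _ (\int[leb]_x (riesz_const%:E * (v x ^+ (2 * n))%:E))).
  apply: le_integral_ge0 => x.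
    apply: integral_ge0 => y _.
    by rewrite mule_ge0 ?mule_ge0 ?newton_ge0// lee_fin ?exprn_ge0 ?below_ge0.
  have [vx|vx] := eqVneq (v x) 0%R.
    rewrite integral0_eq; last first.
      by move=> y _; rewrite vx expr0n gtn_eqF// mul0e.
    by rewrite mule_ge0// lee_fin// exprn_ge0.
  have vp : (0 < v x)%R by rewrite lt_neqAle eq_sym vx v0.
  rewrite ge0_integralZl//; last 3 first.
  - by apply: measurable_newton_slice; exact: measurable_below.
  - by move=> y _; rewrite mule_ge0 ?newton_ge0// lee_fin below_ge0.
  - by rewrite lee_fin exprn_ge0.
  apply: (le_trans (lee_wpmul2l _ (riesz_below x mw w0 w1 vp))).
    by rewrite lee_fin exprn_ge0.
  by rewrite -!EFinM lee_fin mE exprSr mulrCA.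
rewrite ge0_integralZl//.
- by rewrite -[leRHS]mule1 lee_wpmul2l// lee_fin.
- exact/measurable_EFinP/measurable_funX.
- by move=> x _; rewrite lee_fin exprn_ge0.
Qed.

Let measurable_below2 (v w : T -> R) : measurable_fun setT v -> measurable_fun setT w ->
  measurable_fun setT (fun p : T * T => below w (v p.1) p.2).
Proof.
move=> mv mw; apply: measurable_fun_ifT => //.
  by apply: measurable_fun_ler; [exact: (measurableT_comp mw)|exact: (measurableT_comp mv)].
by apply: measurable_funX; exact: (measurableT_comp mw).
Qed.

(** The Hardy-Littlewood-Sobolev inequality in normalised form.  At a pair
    [(x, y)] either [w y <= v x] or [v x <= w y].  By the symmetry of the
    kernel both cases reduce to [riesz_below], whose bound [v x] raises
    [v x ^+ (2 * n - 1)] to the integrable power [v x ^+ (2 * n)]. *)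
Lemma newton_form_le (v w : T -> R) : measurable_fun setT v -> measurable_fun setT w ->
  (forall y, 0 <= v y)%R -> (forall y, 0 <= w y)%R ->
  \int[leb]_y (v y ^+ (2 * n))%:E <= 1 ->
  \int[leb]_y (w y ^+ (2 * n))%:E <= 1 ->
  newton_form (fun x => v x ^+ (2 * n).-1)%R (fun x => w x ^+ (2 * n).-1)%R <=
  (2 * riesz_const)%:E.
Proof.
move=> mv mw v0 w0 v1 w1.
pose F1 (p : T * T) := (v p.1 ^+ m)%:E * ((below w (v p.1) p.2)%:E * newton p.1 p.2).
pose F2 (p : T * T) := (w p.2 ^+ m)%:E * ((below v (w p.2) p.1)%:E * newton p.2 p.1).
have F10 p : 0 <= F1 p.
  by rewrite mule_ge0 ?mule_ge0 ?newton_ge0// lee_fin ?exprn_ge0 ?below_ge0.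
have F20 p : 0 <= F2 p.
  by rewrite mule_ge0 ?mule_ge0 ?newton_ge0// lee_fin ?exprn_ge0 ?below_ge0.
have mF1 : measurable_fun setT F1.
  apply: emeasurable_funM.
    by apply/measurable_EFinP/measurable_funX; exact: (measurableT_comp mv).
  apply: emeasurable_funM; last exact: measurable_newton.
  by apply/measurable_EFinP; exact: measurable_below2.
have mF2 : measurable_fun setT F2.
  pose sw (p : T * T) := (p.2, p.1).
  have msw : measurable_fun setT sw by exact: measurable_fun_pair.
  apply: emeasurable_funM.
    by apply/measurable_EFinP/measurable_funX; exact: (measurableT_comp mw).
  apply: emeasurable_funM; last exact: (measurableT_comp (@measurable_newton R n) msw).
  by apply/measurable_EFinP; exact: (measurableT_comp (measurable_below2 mw mv) msw).
apply: (@le_trans _ _ (\int[leb]_x (\int[leb]_y F1 (x, y) + \int[leb]_y F2 (x, y)))).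
  apply: le_integral_ge0 => x.
    rewrite mule_ge0 ?newton_potential_ge0 ?lee_fin ?exprn_ge0//.
    by move=> y; rewrite exprn_ge0.
  rewrite -ge0_integralZl//; last 3 first.
  - by apply: measurable_newton_slice; exact: measurable_funX.
  - by move=> y _; rewrite mule_ge0 ?newton_ge0// lee_fin exprn_ge0.
  - by rewrite lee_fin exprn_ge0.
  rewrite -ge0_integralD//; last 2 first.
  - exact: (measurableT_comp mF1 (pair1_measurable x)).
  - exact: (measurableT_comp mF2 (pair1_measurable x)).
  apply: le_integral_ge0 => y.
    by rewrite mule_ge0 ?mule_ge0 ?newton_ge0// lee_fin exprn_ge0.
  rewrite /F1 /F2 /= /below.
  have [wv|vw] := leP (w y) (v x).
    by rewrite leeDl//; exact: (F20 (x, y)).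
  by rewrite mul0e mule0 add0e (ltW vw) newtonC muleCA.
rewrite ge0_integralD//; last 4 first.
- by move=> x _; apply: integral_ge0.
- exact: (@measurable_fun_fubini_tonelli_F _ _ _ _ R leb F1).
- by move=> x _; apply: integral_ge0.
- exact: (@measurable_fun_fubini_tonelli_F _ _ _ _ R leb F2).
have -> : (2 * riesz_const = riesz_const + riesz_const)%R.
  by rewrite mulrDl mul1r.
rewrite EFinD; apply: leeD; first exact: (energy_below mv mw).
by rewrite (@fubini_tonelli _ _ _ _ _ leb leb F2)//; exact: (energy_below mw mv).
Qed.

(** Where the kernel is bounded by [c], the form is at most [c] times the
    product of the two L1 norms, and these are controlled by the measures of
    the supports through [integral_expr_le]. *)
Lemma newton_form_separated (v w : T -> R) (E F : set T) (B B' c : R) :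
  measurable_fun setT v -> measurable_fun setT w ->
  (forall y, 0 <= v y)%R -> (forall y, 0 <= w y)%R ->
  \int[leb]_y (v y ^+ (2 * n))%:E <= 1 ->
  \int[leb]_y (w y ^+ (2 * n))%:E <= 1 ->
  measurable E -> measurable F -> (0 < B)%R -> (0 < B')%R -> (0 <= c)%R ->
  leb E <= (B ^+ (2 * n))%:E -> leb F <= (B' ^+ (2 * n))%:E ->
  (forall x, ~ E x -> v x = 0%R) -> (forall x, ~ F x -> w x = 0%R) ->
  (forall x y, E x -> F y -> newton x y <= c%:E) ->
  newton_form (fun x => v x ^+ (2 * n).-1)%R (fun x => w x ^+ (2 * n).-1)%R <=
  (c * (2 * B) * (2 * B'))%:E.
Proof.
move=> mv mw v0 w0 v1 w1 mEs mFs B0 B'0 c0 EB FB' vE wF Nc.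
have restr (u : T -> R) (A : set T) : (forall x, ~ A x -> u x = 0%R) ->
    \int[leb]_x (u x ^+ m)%:E = \int[leb]_(x in A) (u x ^+ m)%:E.
  move=> uA; rewrite [RHS]integral_mkcond; apply: eq_integral => x _.
  rewrite patchE; case: ifPn => //; rewrite notin_setE => /uA ->.
  by rewrite expr0n gtn_eqF//.
have Iv : \int[leb]_x (v x ^+ m)%:E <= (2 * B)%:E.
  by rewrite (restr _ _ vE); apply: integral_expr_le => //; rewrite -mE.
have Iw : \int[leb]_x (w x ^+ m)%:E <= (2 * B')%:E.
  by rewrite (restr _ _ wF); apply: integral_expr_le => //; rewrite -mE.
have mvk (u : T -> R) : measurable_fun setT u -> measurable_fun setT (fun x => (u x ^+ m)%:E).
  by move=> mu_; exact/measurable_EFinP/measurable_funX.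
apply: (@le_trans _ _ (\int[leb]_x ((v x ^+ m)%:E * (c * (2 * B'))%:E))).
  apply: le_integral_ge0 => x.
    rewrite mule_ge0 ?newton_potential_ge0 ?lee_fin ?exprn_ge0//.
    by move=> y; rewrite exprn_ge0.
  have [Ex|nEx] := pselect (E x); last first.
    by rewrite (vE _ nEx) expr0n gtn_eqF// !mul0e.
  rewrite lee_wpmul2l ?lee_fin ?exprn_ge0//.
  apply: (@le_trans _ _ (\int[leb]_y (c%:E * (w y ^+ m)%:E))).
    apply: le_integral_ge0 => y; first by rewrite mule_ge0 ?newton_ge0// lee_fin exprn_ge0.
    have [Fy|nFy] := pselect (F y); last first.
      by rewrite (wF _ nFy) expr0n gtn_eqF// mul0e mule0.
    by rewrite muleC lee_wpmul2r ?lee_fin ?exprn_ge0//; exact: Nc.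
  rewrite ge0_integralZl//.
  - by rewrite EFinM lee_wpmul2l// lee_fin.
  - exact: mvk.
  - by move=> y _; rewrite lee_fin exprn_ge0.
rewrite ge0_integralZr//; last 3 first.
- exact: mvk.
- by move=> x _; rewrite lee_fin exprn_ge0.
- by rewrite lee_fin !mulr_ge0// ltW.
have -> : (c * (2 * B) * (2 * B') = 2 * B * (c * (2 * B')))%R by ring.
by rewrite [leRHS]EFinM lee_wpmul2r// lee_fin !mulr_ge0// ltW.
Qed.

End riesz_potential.

(** * Decay of the kernel between shells *)

Section enorm_triangle.
Context {R : realType} (n : nat).
Implicit Types x y : n.-tuple R.

(** The Cauchy-Schwarz inequality, from the squared norm of
    [enorm y * x - enorm x * y]. *)
Lemma dotp_le_enorm x y : dotp x y <= enorm x * enorm y.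
Proof.
set a := enorm x; set b := enorm y.
have H : 0 <= 2 * (a * b) * (a * b - dotp x y).
  have -> : 2 * (a * b) * (a * b - dotp x y) =
      \sum_(i < n) (b * tnth x i - a * tnth y i) ^+ 2.
    have -> : \sum_(i < n) (b * tnth x i - a * tnth y i) ^+ 2 =
        b ^+ 2 * dotp x x + a ^+ 2 * dotp y y - 2 * (a * b) * dotp x y.
      rewrite /dotp !mulr_sumr -big_split -sumrB; apply: eq_bigr => i _ /=; ring.
    by rewrite -!sqr_enorm -/a -/b; ring.
  by apply: sumr_ge0 => i _; rewrite sqr_ge0.
have [ab|ab] := ltP 0 (a * b).
  by rewrite -subr_ge0; move: H; rewrite pmulr_rge0// mulr_gt0.
have zero z w : enorm z = 0 -> dotp z w = 0.
  move=> z0; rewrite /dotp big1// => i _.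
  have := tnth_le_enorm z i; rewrite z0 normr_le0 => /eqP ->; exact: mul0r.
have : a * b == 0 by rewrite eq_le ab mulr_ge0 ?enorm_ge0.
rewrite mulf_eq0 => /orP[] /eqP h.
  by rewrite zero// mulr_ge0 ?enorm_ge0.
by rewrite dotpC zero// mulr_ge0 ?enorm_ge0.
Qed.

Lemma enorm_le_tdiff x y : enorm x <= enorm (tdiff x y) + enorm y.
Proof.
rewrite -(@ler_pXn2r _ 2) ?nnegrE ?addr_ge0 ?enorm_ge0//.
set t := tdiff x y.
have xE : dotp x x = dotp t t + 2 * dotp t y + dotp y y.
  rewrite /dotp mulr_sumr -!big_split; apply: eq_bigr => i _ /=.
  by rewrite tnth_mktuple; ring.
rewrite sqrrD !sqr_enorm xE; have := dotp_le_enorm t y; lra.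
Qed.

End enorm_triangle.

Section shells.
Context {R : realType} (n : nat) (gamma : R).
Hypotheses (n1 : (1 < n)%N) (gamma1 : 1 < gamma).
Local Notation T := (n.-tuple R).
Local Notation leb := (lebesgue_tuple R n).
Local Notation A := (shell n gamma).

(** The ratio of decay between shells.  For [j < k] the kernel is of size
    [gamma ^ (- k)], and the two L1 norms grow like the square roots of
    [gamma ^ j] and [gamma ^ k]; the product is [rho ^+ (k - j)]. *)
Definition rho : R := (Num.sqrt gamma)^-1.

Let g0 : 0 < gamma. Proof. exact: lt_trans gamma1. Qed.

Let sg0 : 0 < Num.sqrt gamma. Proof. by rewrite sqrtr_gt0. Qed.

Let rho0 : 0 < rho. Proof. by rewrite invr_gt0. Qed.

Lemma rho_lt1 : rho < 1.
Proof. by rewrite invf_lt1// -[ltLHS]sqrtr1 ltr_sqrt. Qed.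

Let sg2 : Num.sqrt gamma ^+ 2 = gamma. Proof. by rewrite sqr_sqrtr// ltW. Qed.

(** The power [2 * n] of this number bounds the volume of the shell: [2 * n] and
    the square root of [gamma] combine to the dimension [n]. *)
Definition shell_radius (k : int) : R := 2 * Num.sqrt gamma ^ (k + 1).

Lemma shell_radius_gt0 k : 0 < shell_radius k.
Proof. by rewrite mulr_gt0// exprz_gt0. Qed.

Lemma lebesgue_shell k : (leb (A k) <= (shell_radius k ^+ (2 * n))%:E)%E.
Proof.
have g1 : 0 < gamma ^ (k + 1) by rewrite exprz_gt0.
pose z : T := [tuple 0 | i < n].
apply: (@le_trans _ _ (leb (eball z (2 * gamma ^ (k + 1))))).
  apply: le_measure; rewrite ?inE; [exact: measurable_shell|exact: measurable_eball|].
  move=> x /andP[_ xg]; rewrite /eball/=.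
  have -> : enorm (tdiff z x) = enorm x.
    rewrite /enorm /dotp; congr (Num.sqrt _); apply: eq_bigr => i _.
    by rewrite !tnth_mktuple !sub0r mulrNN.
  by apply: le_lt_trans xg _; rewrite mulr_natl mulr2n ltrDl.
have g2 : 0 < 2 * gamma ^ (k + 1) by rewrite mulr_gt0.
apply: (le_trans (lebesgue_eball_le z g2)).
have -> : shell_radius k ^+ (2 * n) = (2 * (2 * gamma ^ (k + 1))) ^+ n.
  rewrite exprM; congr (_ ^+ _); rewrite /shell_radius exprMn.
  have -> : (Num.sqrt gamma ^ (k + 1)) ^+ 2 = gamma ^ (k + 1).
    by rewrite expr2 -exprzMl ?unitfE ?gt_eqF// -expr2 sg2.
  ring.
by rewrite lexx.
Qed.

Let kappa : R := (1 - gamma^-1)^-1.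

Let kappa0 : 0 < kappa.
Proof. by rewrite invr_gt0 subr_gt0 invf_lt1. Qed.

Lemma newton_shell (j k : int) x y : j + 2 <= k -> A j x -> A k y ->
  (newton x y <= (kappa * gamma ^ (- k))%:E)%E.
Proof.
move=> jk /andP[_ xj] /andP[yk _].
have gk : 0 < gamma ^ k by rewrite exprz_gt0.
have d : gamma ^ k * (1 - gamma^-1) <= enorm (tdiff y x).
  have := enorm_le_tdiff y x; rewrite -lerBlDr; apply: le_trans.
  rewrite mulrBr mulr1 lerB ?(ltW yk)//; apply: (le_trans xj).
  rewrite -[gamma^-1]exprN1 -expfzDr ?gt_eqF//.
  by rewrite ler_eXz2l//; lia.
rewrite newtonC /newton; have dp : 0 < enorm (tdiff y x).
  by apply: lt_le_trans d; rewrite mulr_gt0// subr_gt0 invf_lt1.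
rewrite inver gt_eqF// lee_fin /kappa -invr_expz -invfM mulrC.
by rewrite lef_pV2 ?posrE ?mulr_gt0// subr_gt0 invf_lt1.
Qed.

Definition shell_const : R := 2 * riesz_const n * gamma + 16 * kappa * gamma.

Lemma shell_const_gt0 : 0 < shell_const.
Proof.
rewrite addr_gt0 ?mulr_gt0//; by rewrite /riesz_const addr_gt0 ?mulr_gt0 ?exprn_gt0.
Qed.

Section normalised.
Variables (v : int -> T -> R).
Hypotheses (mv : forall k, measurable_fun setT (v k)) (v0 : forall k x, 0 <= v k x).
Hypothesis v1 : forall k, (\int[leb]_y (v k y ^+ (2 * n))%:E <= 1)%E.
Hypothesis vA : forall k x, ~ A k x -> v k x = 0.

Let g k : T -> R := fun x => v k x ^+ (2 * n).-1.

Let far (j k : int) (r : nat) : k = j + r%:Z -> (2 <= r)%N ->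
  (newton_form (g j) (g k) <= (16 * kappa * gamma * rho ^+ r)%:E)%E.
Proof.
move=> kj r2.
have N x y : A j x -> A k y -> (newton x y <= (kappa * gamma ^ (- k))%:E)%E.
  by apply: newton_shell; rewrite kj; lia.
have c0 : 0 <= kappa * gamma ^ (- k) by rewrite mulr_ge0 ?exprz_ge0 ?ltW.
have := newton_form_separated n1 (mv j) (mv k) (v0 j) (v0 k) (v1 j) (v1 k)
  (@measurable_shell R n gamma j) (@measurable_shell R n gamma k)
  (shell_radius_gt0 j) (shell_radius_gt0 k) c0
  (lebesgue_shell j) (lebesgue_shell k) (@vA j) (@vA k) N.
rewrite -/(g j) -/(g k) => /le_trans; apply; rewrite lee_fin le_eqVlt; apply/orP/or_introl/eqP.
set s := Num.sqrt gamma; have s0 : s != 0 by rewrite gt_eqF.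
have e1 : gamma ^ (- k) = s ^ (- k) * s ^ (- k).
  by rewrite -exprzMl ?unitfE// -expr2 sg2.
have e2 : s ^ (k + 1) * s ^ (- k) = s.
  by rewrite -expfzDr// addrAC subrr add0r expr1z.
have e3 : s ^ (j + 1) * s ^ (- k) = s * rho ^+ r.
  have -> : rho ^+ r = s ^ (- r%:Z) by rewrite /rho -/s exprVn -invr_expz.
  rewrite -expfzDr// -[X in X * _]expr1z -expfzDr//.
  by congr (_ ^ _); rewrite kj; ring.
rewrite e1 /shell_radius -/s.
transitivity (16 * kappa * (s ^ (k + 1) * s ^ (- k)) * (s ^ (j + 1) * s ^ (- k))).
  ring.
by rewrite e2 e3 -[in RHS]sg2 -/s; ring.
Qed.

Let near (j k : int) (r : nat) : (r < 2)%N ->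
  (newton_form (g j) (g k) <= (2 * riesz_const n * gamma * rho ^+ r)%:E)%E.
Proof.
move=> r2; apply: (le_trans (newton_form_le n1 (mv j) (mv k) (v0 j) (v0 k) (v1 j) (v1 k))).
have c0 : 0 <= 2 * riesz_const n :> R.
  by rewrite mulr_ge0// addr_ge0// mulr_ge0 ?exprn_ge0.
rewrite lee_fin -mulrA -[leLHS]mulr1 ler_wpM2l//.
(* the factor gamma makes up for the at most one power of rho *)
have rg : 1 <= gamma * rho.
  rewrite -[X in X * _]sg2 expr2 -mulrA mulfV ?gt_eqF// mulr1.
  by rewrite -[leLHS]sqrtr1 ler_wsqrtr// ltW.
case: r r2 => [|[|//]] _; first by rewrite mulr1 ltW.
by rewrite expr1.
Qed.

(** Distant shells are treated by [newton_form_separated].  For equal or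
    adjacent shells the kernel is unbounded, and [newton_form_le] is needed. *)
Lemma newton_form_shells (j k : int) :
  (newton_form (g j) (g k) <= (shell_const * rho ^+ `|j - k|)%:E)%E.
Proof.
wlog jk : j k / j <= k.
  move=> H; case: (leP j k) => [|/ltW kj]; first exact: H.
  have mg i : measurable_fun setT (g i) by exact: measurable_funX.
  have g0' i x : 0 <= g i x by rewrite exprn_ge0.
  by rewrite newton_formC// distnC; exact: H.
set r := `|j - k|%N; have kj : k = j + r%:Z by rewrite /r; lia.
have p0 : 0 <= rho ^+ r by rewrite exprn_ge0 ?ltW.
have c0 : 0 <= riesz_const n :> R.
  by rewrite addr_ge0// mulr_ge0 ?exprn_ge0.
have [r2|r2] := ltnP r 2.
  apply: (le_trans (near j k r2)); rewrite lee_fin ler_wpM2r// lerDl.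
  by rewrite !mulr_ge0// ltW.
apply: (le_trans (far kj r2)); rewrite lee_fin ler_wpM2r// lerDr.
by rewrite !mulr_ge0// ltW.
Qed.

End normalised.

End shells.

(** * Almost orthogonality of the shells *)

Section geometric_sum.
Context {R : realType} (q : R).
Hypotheses (q0 : 0 < q) (q1 : q < 1).

Lemma sum_geometric_nat (s : seq nat) : uniq s ->
  \sum_(i <- s) q ^+ i <= (1 - q)^-1.
Proof.
move=> us; pose N := (\max_(i <- s) i).+1.
have -> : \sum_(i <- s) q ^+ i = \sum_(i <- iota 0 N | i \in s) q ^+ i.
  rewrite -[RHS]big_filter; apply: perm_big; apply: uniq_perm => //.
    by rewrite filter_uniq// iota_uniq.
  move=> i; rewrite mem_filter mem_iota add0n leq0n/=.
  case: (boolP (i \in s)) => //= si; apply/esym; rewrite ltnS.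
  by rewrite (big_rem i si)/= leq_maxl.
apply: (@le_trans _ _ (\sum_(i <- iota 0 N) q ^+ i)).
  rewrite [leRHS](bigID (mem s))/= lerDl; apply: sumr_ge0 => i _.
  by rewrite exprn_ge0 ?ltW.
rewrite -[X in iota _ X]subn0 -/(index_iota 0 N) big_mkord.
have d : 0 < 1 - q by rewrite subr_gt0.
rewrite -[leRHS]mulr1 ler_pdivlMl//.
have -> : (1 - q) * \sum_(i < N) q ^+ i = 1 - q ^+ N.
  by rewrite -[RHS]opprB subrX1 -mulNr opprB.
by rewrite gerBl exprn_ge0 ?ltW.
Qed.

Lemma sum_geometric_int (j : int) (s : seq int) : uniq s ->
  \sum_(k <- s) q ^+ `|j - k| <= 2 / (1 - q).
Proof.
move=> us; rewrite (bigID (fun k => j <= k))/= mulr_natl mulr2n.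
have half (P : pred int) :
    (forall x y, P x -> P y -> `|j - x|%N = `|j - y|%N -> x = y) ->
    \sum_(k <- s | P k) q ^+ `|j - k| <= (1 - q)^-1.
  move=> inj; rewrite -big_filter -(big_map (fun k => `|j - k|%N) xpredT (fun i => q ^+ i)).
  apply: sum_geometric_nat; rewrite map_inj_in_uniq ?filter_uniq//.
  by move=> x y; rewrite !mem_filter => /andP[xP _] /andP[yP _]; exact: inj.
apply: lerD; apply: half => x y hx hy; lia.
Qed.

(** Schur's test: [a j * a k] is at most half the sum of the squares, and each
    row of the matrix [q ^+ |j - k|] has sum at most [2 / (1 - q)]. *)
Lemma schur_sum (a : int -> R) (s : seq int) : uniq s -> (forall k, 0 <= a k) ->
  \sum_(j <- s) \sum_(k <- s) a j * a k * q ^+ `|j - k| <=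
  2 / (1 - q) * \sum_(k <- s) a k ^+ 2.
Proof.
move=> us a0.
have qn i : 0 <= q ^+ i by rewrite exprn_ge0 ?ltW.
have one : \sum_(j <- s) \sum_(k <- s) a j ^+ 2 * q ^+ `|j - k| <=
    2 / (1 - q) * \sum_(k <- s) a k ^+ 2.
  rewrite mulr_sumr; apply: ler_sum => j _.
  by rewrite -mulr_sumr mulrC ler_wpM2r ?sqr_ge0// sum_geometric_int.
have two : \sum_(j <- s) \sum_(k <- s) a k ^+ 2 * q ^+ `|j - k| <=
    2 / (1 - q) * \sum_(k <- s) a k ^+ 2.
  rewrite exchange_big/=; apply: le_trans one; apply: ler_sum => j _.
  by apply: ler_sum => k _; rewrite distnC.
have : 2 * (\sum_(j <- s) \sum_(k <- s) a j * a k * q ^+ `|j - k|) <=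
    \sum_(j <- s) \sum_(k <- s) a j ^+ 2 * q ^+ `|j - k| +
    \sum_(j <- s) \sum_(k <- s) a k ^+ 2 * q ^+ `|j - k|.
  rewrite mulr_sumr -big_split; apply: ler_sum => j _ /=.
  rewrite mulr_sumr -big_split; apply: ler_sum => k _ /=.
  rewrite mulrA -mulrDl ler_wpM2r// -subr_ge0.
  by have := sqr_ge0 (a j - a k); rewrite sqrrB; lra.
lra.
Qed.

End geometric_sum.

Lemma newton_form_suml (R : realType) (n : nat) (I : Type) (s : seq I)
    (f : I -> n.-tuple R -> R) (h : n.-tuple R -> R) :
  (forall i, measurable_fun setT (f i)) -> measurable_fun setT h ->
  (forall i x, 0 <= f i x) -> (forall x, 0 <= h x) ->
  (newton_form (fun x => \sum_(i <- s) f i x)%R h = \sum_(i <- s) newton_form (f i) h)%E.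
Proof.
move=> mf mh f0 h0; rewrite /newton_form -ge0_integral_sum//.
- apply: eq_integral => x _; rewrite -ge0_sume_distrl ?sumEFin//.
  by move=> i _; rewrite lee_fin.
- move=> i; apply: emeasurable_funM; first exact/measurable_EFinP.
  exact: measurable_newton_potential.
- by move=> i x _; rewrite mule_ge0 ?newton_potential_ge0 ?lee_fin.
Qed.

Section core.
Context {R : realType} (n : nat) (gamma : R).
Hypotheses (n1 : (1 < n)%N) (gamma1 : 1 < gamma).
Local Notation T := (n.-tuple R).
Local Notation leb := (lebesgue_tuple R n).
Local Notation A := (shell n gamma).

Let g0 : 0 < gamma. Proof. exact: lt_trans gamma1. Qed.

Let rho0 : 0 < rho gamma. Proof. by rewrite invr_gt0 sqrtr_gt0. Qed.

Definition schur_const : R := shell_const n gamma * (2 / (1 - rho gamma)).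

Lemma schur_const_gt0 : 0 < schur_const.
Proof.
rewrite mulr_gt0 ?shell_const_gt0// divr_gt0// subr_gt0; exact: rho_lt1.
Qed.

Variables (v : T -> R) (a : int -> R) (F : seq int).
Hypotheses (mv : measurable_fun setT v) (v0 : forall x, 0 <= v x).
Hypothesis uF : uniq F.
Hypothesis a0 : forall k, 0 < a k.
Hypothesis av : forall k, k \in F ->
  (\int[leb]_(x in A k) (v x ^+ (2 * n))%:E = (a k ^+ (2 * n))%:E)%E.

Let w k x : R := if k \in F then v x * \1_(A k) x / a k else 0.

Let w0 k x : 0 <= w k x.
Proof. by rewrite /w; case: ifP => // _; rewrite divr_ge0 ?mulr_ge0// ltW. Qed.

Let mw k : measurable_fun setT (w k).
Proof.
rewrite (_ : w k = if k \in F then fun x => v x * \1_(A k) x / a k else cst 0); last first.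
  by apply/funext => x; rewrite /w; case: ifP.
case: ifP => // _; apply: measurable_funM => //.
by apply: measurable_funM => //; apply: measurable_indic; exact: measurable_shell.
Qed.

Let wA k x : ~ A k x -> w k x = 0.
Proof.
by move=> nA; rewrite /w; case: ifP => // _; rewrite indicE memNset// mulr0 mul0r.
Qed.

Let n20 : (0 < 2 * n)%N. Proof. by rewrite muln_gt0 (ltnW n1). Qed.

Let w1F k : k \in F -> (\int[leb]_y (w k y ^+ (2 * n))%:E = 1)%E.
Proof.
move=> kF; have ak : 0 < a k ^+ (2 * n) by rewrite exprn_gt0.
transitivity ((a k ^- (2 * n))%:E * \int[leb]_(x in A k) (v x ^+ (2 * n))%:E)%E.
  rewrite (integral_mkcond (A k)) -ge0_integralZl//; last 3 first.
  - apply/(measurable_restrictT _ (measurable_shell gamma k)).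
    by apply/measurable_EFinP/measurable_funTS; exact: measurable_funX.
  - move=> x _; rewrite patchE; case: ifP => // _.
    by rewrite lee_fin exprn_ge0.
  - by rewrite lee_fin invr_ge0 ltW.
  apply: eq_integral => x _; rewrite /w kF patchE indicE.
  case: ifP => _; last by rewrite mulr0 mul0r expr0n gtn_eqF// mule0.
  by rewrite mulr1 -EFinM exprMn exprVn mulrC.
by rewrite av// -EFinM mulVf// gt_eqF.
Qed.

Let w1 k : (\int[leb]_y (w k y ^+ (2 * n))%:E <= 1)%E.
Proof.
have [kF|kF] := boolP (k \in F); first by rewrite w1F.
rewrite integral0_eq// => x _; rewrite /w (negbTE kF) expr0n.
by rewrite gtn_eqF.
Qed.

Let g k x : R := w k x ^+ (2 * n).-1.

Let mg k : measurable_fun setT (g k). Proof. exact: measurable_funX. Qed.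

Let g_ge0 k x : 0 <= g k x. Proof. exact: exprn_ge0. Qed.

(** On the shell [k] this is [a k ^ (2 - 2n) * v ^+ (2 * n - 1)], the function
    that realises the norm of [v] in the duality between l2(L^(2n)) and
    l2(L^p), where [p] is the exponent conjugate to [2 * n]. *)
Definition dual_function (x : T) : R := \sum_(k <- F) a k * g k x.

Lemma measurable_dual : measurable_fun setT dual_function.
Proof. by apply: measurable_sum => k; apply: measurable_funM. Qed.

Lemma dual_ge0 x : 0 <= dual_function x.
Proof. by apply: sumr_ge0 => k _; rewrite mulr_ge0// ltW. Qed.

Lemma dual_energy :
  (newton_energy dual_function <= (schur_const * \sum_(k <- F) a k ^+ 2)%:E)%E.
Proof.
have mag k : measurable_fun setT (fun x => a k * g k x) by exact: measurable_funM.
have ag0 k x : 0 <= a k * g k x by rewrite mulr_ge0// ltW.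
have scale k (h : T -> R) : measurable_fun setT h -> (forall x, 0 <= h x) ->
    newton_form (fun x => a k * g k x) h = ((a k)%:E * newton_form (g k) h)%E.
  move=> mh h0; rewrite /newton_form -ge0_integralZl//.
  - by apply: eq_integral => x _; rewrite EFinM muleA.
  - apply: emeasurable_funM; first exact/measurable_EFinP.
    exact: measurable_newton_potential.
  - by move=> x _; rewrite mule_ge0 ?newton_potential_ge0 ?lee_fin.
  - by rewrite lee_fin ltW.
rewrite -[newton_energy _]/(newton_form dual_function dual_function).
rewrite newton_form_suml//; [|exact: measurable_dual|exact: dual_ge0].
apply: (@le_trans _ _ (\sum_(j <- F) \sum_(k <- F)
   (a j * a k * (shell_const n gamma * rho gamma ^+ `|j - k|))%:E)%E).
  apply: lee_sum => j _.
  rewrite newton_formC//; [|exact: measurable_dual|exact: dual_ge0].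
  rewrite newton_form_suml//; apply: lee_sum => k _.
  rewrite scale// newton_formC// scale// muleA -EFinM mulrC EFinM.
  rewrite [leRHS]EFinM lee_wpmul2l ?lee_fin ?mulr_ge0 ?(ltW (a0 _))//.
  exact: (newton_form_shells n1 gamma1 mw w0 w1 wA).
rewrite (eq_bigr (fun j => (\sum_(k <- F)
   a j * a k * (shell_const n gamma * rho gamma ^+ `|j - k|))%:E)); last first.
  by move=> j _; rewrite sumEFin.
rewrite sumEFin lee_fin.
have := schur_sum rho0 (rho_lt1 gamma1) uF (fun k => ltW (a0 k)).
move=> /(ler_wpM2l (ltW (shell_const_gt0 n gamma1))).
rewrite mulrA -/schur_const; apply: le_trans.
rewrite mulr_sumr; apply: ler_sum => j _; rewrite mulr_sumr; apply: ler_sum => k _.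
by rewrite mulrCA.
Qed.

Lemma dual_pairing (u : T -> \bar R) : (forall x, ((v x)%:E <= u x)%E) ->
  ((\sum_(k <- F) a k ^+ 2)%:E <= \int[leb]_x ((dual_function x)%:E * u x))%E.
Proof.
move=> vu.
apply: (@le_trans _ _ (\int[leb]_x \sum_(k <- F) (a k * (g k x * v x))%:E)%E).
  rewrite ge0_integral_sum//; last 2 first.
  - move=> k; apply/measurable_EFinP; apply: measurable_funM => //.
    exact: measurable_funM.
  - by move=> k x _; rewrite lee_fin mulr_ge0 ?mulr_ge0// ltW.
  rewrite -sumEFin big_seq [leRHS]big_seq; apply: lee_sum => k kF.
  have E x : a k * (g k x * v x) = a k ^+ 2 * w k x ^+ (2 * n).
    have -> : (2 * n = (2 * n).-1.+1)%N by rewrite prednK.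
    rewrite [w k x ^+ (_.+1)]exprSr /g; have [wk|wk] := eqVneq (w k x) 0.
      rewrite wk expr0n gtn_eqF ?mul0r ?mulr0//.
      by rewrite -ltnS prednK// (leq_trans n1)// leq_pmull.
    have -> : v x = a k * w k x.
      move: wk; rewrite /w kF indicE; case: (x \in A k) => /=.
        by move=> _; rewrite mulr1; field; rewrite gt_eqF.
      by rewrite mulr0 mul0r eqxx.
    by ring.
  under eq_integral do rewrite E EFinM.
  rewrite ge0_integralZl ?w1F ?mule1//.
  - by apply/measurable_EFinP/measurable_funX.
  - by move=> x _; rewrite lee_fin exprn_ge0.
  - by rewrite lee_fin sqr_ge0.
apply: le_integral_ge0 => x.
  by apply: sume_ge0 => k _; rewrite lee_fin mulr_ge0 ?mulr_ge0// ltW.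
rewrite sumEFin (_ : \sum_(k <- F) _ = dual_function x * v x).
  by rewrite EFinM lee_wpmul2l// lee_fin dual_ge0.
by rewrite /dual_function mulr_suml; apply: eq_bigr => k _; rewrite mulrA.
Qed.

(** With [S] the sum of the squares and [C] the constant of [dual_energy], the
    pairing gives [S <= l * X + (c * C / l) * S].  The choice [l = 2 * c * C]
    leaves [S / 2] on the right, which can be subtracted as [S] is finite. *)
Lemma shell_norms_le (u : T -> \bar R) (X : \bar R) (c : R) : 0 < c -> (0 <= X)%E ->
  (forall x, ((v x)%:E <= u x)%E) ->
  (forall f : T -> R, measurable_fun setT f -> (forall x, 0 <= f x) ->
     forall l, 0 < l -> (\int[leb]_x ((f x)%:E * u x) <=
       l%:E * X + (l^-1 * c)%:E * newton_energy f)%E) ->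
  ((\sum_(k <- F) a k ^+ 2)%:E <= (4 * c * schur_const)%:E * X)%E.
Proof.
move=> c0 X0 vu pair; set S := \sum_(k <- F) _.
have C0 := schur_const_gt0.
have l0 : 0 < 2 * c * schur_const by rewrite mulr_gt0// mulr_gt0.
have := le_trans (dual_pairing vu) (pair _ measurable_dual dual_ge0 _ l0).
have lc : (0 <= ((2 * c * schur_const)^-1 * c)%:E)%E.
  by rewrite lee_fin mulr_ge0 ?invr_ge0 ?(ltW l0) ?(ltW c0).
move=> /le_trans /(_ (leeD2l _ (lee_wpmul2l lc dual_energy))).
rewrite -/S -EFinM.
have -> : (2 * c * schur_const)^-1 * c * (schur_const * S) = S / 2.
  by field; rewrite !gt_eqF.
case: X X0 {pair} => [X| |]// X0.
  by rewrite -!EFinM -EFinD !lee_fin; lra.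
by move=> _; rewrite gt0_muley ?leey// lte_fin mulr_gt0// mulr_gt0.
Qed.

End core.

(** * From the pairing to the norms on the shells *)

Section shell_norms.
Context {R : realType} (n : nat) (gamma : R).
Hypotheses (n1 : (1 < n)%N) (gamma1 : 1 < gamma).
Local Notation T := (n.-tuple R).
Local Notation leb := (lebesgue_tuple R n).
Local Notation A := (shell n gamma).
Variables (u : T -> \bar R) (X c : R).
Hypotheses (mu : measurable_fun setT u) (u0 : forall x, (0 <= u x)%E).
Hypotheses (X0 : 0 <= X) (c0 : 0 < c).
Hypothesis pair : forall f : T -> R, measurable_fun setT f -> (forall x, 0 <= f x) ->
  forall l, 0 < l -> (\int[leb]_x ((f x)%:E * u x) <=
    l%:E * X%:E + (l^-1 * c)%:E * newton_energy f)%E.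

Let K := 4 * c * schur_const n gamma.

Let n20 : (0 < 2 * n)%N. Proof. by rewrite muln_gt0 (ltnW n1). Qed.

Let KX0 : 0 <= K * X.
Proof.
by rewrite mulr_ge0// mulr_ge0 ?(ltW (schur_const_gt0 n gamma1))// mulr_ge0 ?ltW.
Qed.

Definition rootn (I : R) : R := I `^ (2 * n)%:R^-1.

Lemma rootn_gt0 I : 0 < I -> 0 < rootn I. Proof. exact: powR_gt0. Qed.

Lemma rootnK I : 0 <= I -> rootn I ^+ (2 * n) = I.
Proof.
move=> I0; rewrite -powR_mulrn ?powR_ge0// -powRrM mulVf ?powRr1//.
by rewrite pnatr_eq0 -lt0n.
Qed.

Let umin (M : nat) (x : T) : \bar R := Order.min (u x) M%:R%:E.

Let vM (M : nat) (x : T) : R := fine (umin M x).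

Let umin_fin M x : umin M x \is a fin_num.
Proof.
rewrite ge0_fin_numE; last by rewrite /umin le_min u0 lee_fin ler0n.
by rewrite /umin gt_min ltry orbT.
Qed.

Let vME M x : (vM M x)%:E = umin M x. Proof. by rewrite /vM fineK. Qed.

Let vM0 M x : 0 <= vM M x.
Proof. by rewrite -lee_fin vME /umin le_min u0 lee_fin ler0n. Qed.

Let vMM M x : vM M x <= M%:R.
Proof. by rewrite -lee_fin vME /umin ge_min lexx orbT. Qed.

Let vMu M x : ((vM M x)%:E <= u x)%E.
Proof. by rewrite vME /umin ge_min lexx. Qed.

Let measurable_fine_comp (w : T -> \bar R) : measurable_fun setT w ->
  measurable_fun setT (fun x => fine (w x)).
Proof. by move=> mw; exact: measurableT_comp. Qed.

Let mvM M : measurable_fun setT (vM M).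
Proof. by apply: measurable_fine_comp; exact: measurable_mine. Qed.

Let shell_lty k : (leb (A k) < +oo)%E.
Proof. by apply: le_lt_trans; [exact: lebesgue_shell|exact: ltry]. Qed.

Let measurable_powshell k (w : T -> R) j : measurable_fun setT w ->
  measurable_fun (A k) (fun x => (w x ^+ j)%:E).
Proof. by move=> mw; apply/measurable_EFinP/measurable_funTS; exact: measurable_funX. Qed.

(** The shells on which [v] vanishes almost everywhere are left out, since
    [shell_norms_le] divides by the norms. *)
Let shells_le (v : T -> R) (F : seq int) (b : int -> R) :
  measurable_fun setT v -> (forall x, 0 <= v x) -> (forall x, ((v x)%:E <= u x)%E) ->
  uniq F -> (forall k, 0 <= b k) ->
  (forall k, \int[leb]_(x in A k) (v x ^+ (2 * n))%:E = (b k)%:E)%E ->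
  \sum_(k <- F) rootn (b k) ^+ 2 <= K * X.
Proof.
move=> mv v0 vu uF b0 vb.
pose a k := if 0 < b k then rootn (b k) else 1.
have a0 k : 0 < a k by rewrite /a; case: ifP => // h; exact: rootn_gt0.
pose F' := [seq k <- F | 0 < b k].
have uF' : uniq F' by rewrite filter_uniq.
have va k : k \in F' -> (\int[leb]_(x in A k) (v x ^+ (2 * n))%:E = (a k ^+ (2 * n))%:E)%E.
  by rewrite mem_filter => /andP[bk _]; rewrite vb /a bk rootnK.
have := shell_norms_le n1 gamma1 mv v0 uF' a0 va c0 (X := X%:E) X0 vu pair.
rewrite -EFinM lee_fin; apply: le_trans.
rewrite big_filter (bigID (fun k => 0 < b k))/= -[leRHS]addr0; apply: lerD.
  by apply: ler_sum => k bk; rewrite /a bk.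
rewrite big1// => k bk; have -> : b k = 0.
  by apply/eqP; rewrite eq_le b0 andbT leNgt.
by rewrite /rootn powR0 ?expr0n// invr_eq0 pnatr_eq0 -lt0n.
Qed.

(** Truncation makes the norm on a shell finite, which [shell_norms_le]
    presupposes; the resulting bound does not depend on the height. *)
Let trunc_bound (M : nat) k :
  (\int[leb]_(x in A k) (vM M x ^+ (2 * n))%:E <= ((K * X) ^+ n)%:E)%E.
Proof.
have mA j : measurable (A j) by exact: measurable_shell.
have I0 j : (0 <= \int[leb]_(x in A j) (vM M x ^+ (2 * n))%:E)%E.
  by apply: integral_ge0 => x _; rewrite lee_fin exprn_ge0.
have Ify j : (\int[leb]_(x in A j) (vM M x ^+ (2 * n))%:E < +oo)%E.
  apply: (@le_lt_trans _ _ (\int[leb]_(x in A j) (M%:R ^+ (2 * n))%:E)%E).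
    apply: ge0_le_integral => //.
    - by move=> x _; rewrite lee_fin exprn_ge0.
    - exact: measurable_powshell.
    - by move=> x _; rewrite lee_fin lerXn2r ?nnegrE.
  rewrite integral_cst//; apply: lte_mul_pinfty => //.
  exact: shell_lty.
pose b j := fine (\int[leb]_(x in A j) (vM M x ^+ (2 * n))%:E)%E.
have bE j : (\int[leb]_(x in A j) (vM M x ^+ (2 * n))%:E = (b j)%:E)%E.
  by rewrite fineK// ge0_fin_numE.
have b0 j : 0 <= b j by rewrite fine_ge0.
have := shells_le (mvM M) (vM0 M) (vMu M) (isT : uniq [:: k]) b0 bE.
rewrite big_seq1 bE lee_fin => h.
by rewrite -[leLHS]rootnK// exprM lerXn2r ?nnegrE ?sqr_ge0//.
Qed.

Let ndv x : {homo (fun M => (vM M x ^+ (2 * n))%:E) : i j / (i <= j)%N >-> (i <= j)%E}.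
Proof.
move=> i j ij; rewrite lee_fin lerXn2r ?nnegrE// -lee_fin !vME /umin.
by rewrite le_min !ge_min lexx/= lee_fin ler_nat ij orbT.
Qed.

Let ell x : \bar R := limn (fun M => (vM M x ^+ (2 * n))%:E).

Let vM_le_ell M x : ((vM M x ^+ (2 * n))%:E <= ell x)%E.
Proof.
apply: lime_ge; first exact: ereal_nondecreasing_is_cvgn (ndv x).
by near=> N; apply: ndv; near: N; exact: nbhs_infty_ge.
Unshelve. all: by end_near. Qed.

Let ell_ge0 x : (0 <= ell x)%E.
Proof. by apply: le_trans (vM_le_ell 0%N x); rewrite lee_fin exprn_ge0. Qed.

Let mell : measurable_fun setT ell.
Proof.
apply: (emeasurable_fun_cvg (fun M x => (vM M x ^+ (2 * n))%:E)) => [M|x _].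
  exact/measurable_EFinP/measurable_funX.
exact: (ereal_nondecreasing_is_cvgn (ndv x)).
Qed.

Let integral_ell k : (\int[leb]_(x in A k) ell x <= ((K * X) ^+ n)%:E)%E.
Proof.
have mA : measurable (A k) by exact: measurable_shell.
rewrite monotone_convergence//; last 2 first.
- by move=> M; exact: measurable_powshell.
- by move=> M x _; rewrite lee_fin exprn_ge0.
apply: lime_le; last by apply: nearW => M; exact: trunc_bound.
apply: ereal_nondecreasing_is_cvgn => i j ij; apply: ge0_le_integral => //.
- by move=> x _; rewrite lee_fin exprn_ge0.
- exact: measurable_powshell.
- exact: measurable_powshell.
- by move=> x _; exact: ndv.
Qed.

Lemma ae_shell_fin k : {ae leb, forall x, A k x -> u x \is a fin_num}.
Proof.
have mA : measurable (A k) by exact: measurable_shell.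
have iell : leb.-integrable (A k) ell.
  apply/integrableP; split; first exact: measurable_funTS.
  under eq_integral do rewrite gee0_abs//.
  by apply: le_lt_trans (integral_ell k) _; rewrite ltry.
apply: filterS (integrable_ae mA iell) => x H Ax; have := H Ax.
rewrite !ge0_fin_numE// => ellx; rewrite ltey; apply/eqP => ux.
have h M : (M%:R%:E <= ell x)%E.
  apply: le_trans (vM_le_ell M x); rewrite /vM /umin ux min_r ?leey//=.
  rewrite lee_fin; case: M => [|M]; first by rewrite exprn_ge0.
  by rewrite ler_eXnr// ler1n.
move: ellx; have -> : ell x = +oo%E; last by rewrite ltxx.
apply/eqyP => r r0; apply: le_trans (h (Num.truncn r).+1).
by rewrite lee_fin ltW// truncnS_gt.
Qed.

Let v x : R := fine (u x).

Let v0 x : 0 <= v x. Proof. exact: fine_ge0. Qed.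

Let mv : measurable_fun setT v. Proof. exact: measurable_fine_comp. Qed.

Let vu x : ((v x)%:E <= u x)%E.
Proof. by rewrite /v; have := u0 x; case: (u x). Qed.

Let v_ell x : ((v x ^+ (2 * n))%:E <= ell x)%E.
Proof.
have [ux|ux] := boolP (u x \is a fin_num); last first.
  have -> : v x = 0.
    by move: ux; rewrite ge0_fin_numE// ltey negbK /v => /eqP ->.
  by rewrite expr0n gtn_eqF.
apply: le_trans (vM_le_ell (Num.truncn (v x)).+1 x).
rewrite /vM /umin min_l// -[u x]fineK// lee_fin ltW//; exact: truncnS_gt.
Qed.

(** [fine] turns the value [+oo] into 0; by [ae_shell_fin] this changes [u] on a
    null set only. *)
Definition shell_mass (k : int) : R :=
  fine (\int[leb]_(x in A k) (fine (u x) ^+ (2 * n))%:E)%E.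

Lemma shell_massE k :
  (\int[leb]_(x in A k) (fine (u x) ^+ (2 * n))%:E = (shell_mass k)%:E)%E.
Proof.
have mA : measurable (A k) by exact: measurable_shell.
rewrite fineK// ge0_fin_numE; last first.
  by apply: integral_ge0 => x _; rewrite lee_fin; exact: (exprn_ge0 _ (v0 x)).
apply: (@le_lt_trans _ _ (\int[leb]_(x in A k) ell x)%E).
  apply: ge0_le_integral => //.
  - by move=> x _; rewrite lee_fin; exact: (exprn_ge0 _ (v0 x)).
  - exact: measurable_powshell.
  - exact: measurable_funTS.
  - by move=> x _; exact: v_ell.
by apply: le_lt_trans (integral_ell k) _; rewrite ltry.
Qed.

Lemma shell_mass_ge0 k : 0 <= shell_mass k.
Proof.
rewrite -lee_fin -shell_massE; apply: integral_ge0 => x _.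
by rewrite lee_fin; exact: (exprn_ge0 _ (v0 x)).
Qed.

Lemma sum_shell_mass (F : seq int) : uniq F ->
  \sum_(k <- F) rootn (shell_mass k) ^+ 2 <= K * X.
Proof. by move=> uF; apply: (shells_le mv v0 vu uF shell_mass_ge0 shell_massE). Qed.

End shell_norms.

(** * The shells exhaust the space *)

Section punctured_space.
Context {R : realType} (n : nat) (gamma : R).
Hypotheses (n0 : (0 < n)%N) (gamma1 : 1 < gamma).

Let g0 : 0 < gamma. Proof. exact: lt_trans gamma1. Qed.

Let exists_expr_gt (M : R) : exists N : nat, M < gamma ^+ N.
Proof.
have g1 : 0 < gamma - 1 by rewrite subr_gt0.
have bern N : 1 + N%:R * (gamma - 1) <= gamma ^+ N.
  elim: N => [|N IH]; first by rewrite mul0r addr0.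
  rewrite exprS; apply: le_trans (ler_wpM2l (ltW g0) IH).
  rewrite -subr_ge0 (_ : _ - _ = N%:R * (gamma - 1) ^+ 2).
    by rewrite mulr_ge0 ?sqr_ge0.
  by rewrite -natr1; ring.
exists (Num.truncn (M / (gamma - 1))).+1; apply: lt_le_trans (bern _).
by apply: ltr_wpDl => //; rewrite -ltr_pdivrMr// truncnS_gt.
Qed.

(** The index is found as a least natural number after a shift by [N], where
    [gamma ^ (- N)] is below the norm of [x]. *)
Lemma shell_cover (x : n.-tuple R) : 0 < enorm x -> exists k, shell n gamma k x.
Proof.
move=> x0; set r := enorm x.
have gz (i : int) : 0 < gamma ^ i by rewrite exprz_gt0.
have [N hN] := exists_expr_gt r^-1.
have [M hM] := exists_expr_gt r.
have ex : exists m : nat, r <= gamma ^ (m%:Z - N%:Z + 1).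
  exists (M + N)%N; apply: (le_trans (ltW hM)).
  by rewrite exprnP ler_eXz2l//; lia.
case: (ex_minnP ex) => m hm mmin; exists (m%:Z - N%:Z); apply/andP; split => //.
case: m hm mmin => [|m] hm mmin.
  rewrite sub0r -invr_expz -[X in _ < X]invrK ltf_pV2 ?posrE ?invr_gt0//.
rewrite ltNge; apply/negP => h.
suff /mmin : r <= gamma ^ (m%:Z - N%:Z + 1) by rewrite ltnn.
by apply: le_trans h _; rewrite ler_eXz2l//; lia.
Qed.

Lemma lebesgue_origin : lebesgue_tuple R n [set x | enorm x = 0] = 0%E.
Proof.
have mo : measurable [set x : n.-tuple R | enorm x = 0].
  rewrite (_ : [set x | _] = setT `&` @enorm R n @^-1` [set 0]); last by rewrite setTI.
  by apply: measurable_enorm.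
apply/eqP; rewrite -measure_le0.
apply: (@le_trans _ _ (lebesgue_tuple R n [set x | forall i, [set 0] (tnth x i)])).
  apply: le_measure; rewrite ?inE//; first exact: (@measurable_box _ _ (fun=> [set 0])).
  move=> x /= x0 i; have := tnth_le_enorm x i; rewrite x0 normr_le0.
  by move/eqP.
rewrite (@lebesgue_tuple_box _ _ (fun=> [set 0]))//.
by rewrite (bigD1 (Ordinal n0))//= lebesgue_measure_set1 mul0e.
Qed.

(** Almost everywhere statements on countably many shells add up, and the
    shells miss the origin only. *)
Lemma ae_shells (P : n.-tuple R -> Prop) :
  (forall k, {ae lebesgue_tuple R n, forall x, shell n gamma k x -> P x}) ->
  {ae lebesgue_tuple R n, forall x, P x}.
Proof.
move=> H.
have nullk (k : int) : (lebesgue_tuple R n).-negligible (~` [set x | shell n gamma k x -> P x]).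
  exact: H.
pose B (i : nat) : set (n.-tuple R) := match (unpickle i : option int) with
  | Some k => ~` [set x | shell n gamma k x -> P x] | None => set0 end.
have nB i : (lebesgue_tuple R n).-negligible (B i).
  by rewrite /B; case: (unpickle i) => [k|]; [exact: nullk|exact: negligible_set0].
have no : (lebesgue_tuple R n).-negligible [set x | enorm x = 0].
  exists [set x | enorm x = 0]; split => //; last exact: lebesgue_origin.
  rewrite (_ : [set x | _] = setT `&` @enorm R n @^-1` [set 0]); last by rewrite setTI.
  by apply: measurable_enorm.
have := negligibleU no (negligible_bigcup nB); apply: negligibleS => x /= nP.
have [x0|x0] := eqVneq (enorm x) 0; [by left|right].
have [k xk] : exists k, shell n gamma k x.
  by apply: shell_cover; rewrite lt_neqAle eq_sym x0 enorm_ge0.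
by exists (pickle k) => //; rewrite /B pickleK => /= /(_ xk).
Qed.

End punctured_space.

(** * The modulus of the adjoint Radon transform *)

Lemma normc_ge0 (R : rcfType) (z : R[i]) : 0 <= Normc.normc z.
Proof. by case: z => a b; exact: sqrtr_ge0. Qed.

Lemma Re_le_normc (R : rcfType) (z : R[i]) : `|complex.Re z| <= Normc.normc z.
Proof.
case: z => a b /=; rewrite -sqrtr_sqr; apply: ler_wsqrtr.
by rewrite lerDl sqr_ge0.
Qed.

Lemma Im_le_normc (R : rcfType) (z : R[i]) : `|complex.Im z| <= Normc.normc z.
Proof.
case: z => a b /=; rewrite -sqrtr_sqr; apply: ler_wsqrtr.
by rewrite lerDr sqr_ge0.
Qed.

Lemma normc_le (R : rcfType) (z : R[i]) :
  Normc.normc z <= `|complex.Re z| + `|complex.Im z|.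
Proof.
case: z => a b /=; rewrite -[leRHS]ger0_norm ?addr_ge0// -[leRHS]sqrtr_sqr.
apply: ler_wsqrtr; rewrite sqrrD !real_normK ?num_real// lerD2r lerDl.
by rewrite mulrn_wge0// mulr_ge0.
Qed.

Section adjoint.
Context {R : realType} (n : nat).
Local Notation T := (n.-tuple R).
Local Notation S := (sphere_measure R n).
Local Notation D := ([set: R] `*` sphere n : set (R * T)).
Variable G : R * T -> R[i].
Hypothesis mG : cmeasurable_fun D G.

(** Extended by 0 outside the sphere, so that it is measurable on the whole
    product. *)
Definition modulus : R * T -> R := (fun p => Normc.normc (G p)) \_ D.

Let mD : measurable D.
Proof. by apply: measurableX => //; exact: measurable_sphere. Qed.

Lemma modulus_ge0 p : 0 <= modulus p.
Proof. by rewrite /modulus patchE; case: ifP => // _; exact: normc_ge0. Qed.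

Lemma measurable_modulus : measurable_fun setT modulus.
Proof.
have [mRe mIm] := mG.
apply/(measurable_restrictT _ mD).
rewrite (_ : (fun p => _) = fun p =>
    (complex.Re (G p) ^+ 2 + complex.Im (G p) ^+ 2) `^ 2^-1); last first.
  apply/funext => p; rewrite powR12_sqrt; last by rewrite addr_ge0 ?sqr_ge0.
  by case: (G p).
apply: (@measurableT_comp _ _ _ _ _ _ (@powR R ^~ 2^-1)) => //.
by apply: measurable_funD; exact: measurable_funX.
Qed.

Definition abs_adjoint (x : T) : \bar R := (\int[S]_w (modulus (dotp x w, w))%:E)%E.

Lemma abs_adjoint_ge0 x : (0 <= abs_adjoint x)%E.
Proof. by apply: integral_ge0 => w _; rewrite lee_fin modulus_ge0. Qed.

Lemma measurable_abs_adjoint : measurable_fun setT abs_adjoint.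
Proof.
pose F (p : T * T) := (modulus (dotp p.1 p.2, p.2))%:E.
apply: (@measurable_fun_fubini_tonelli_F _ _ _ _ R S F).
  apply/measurable_EFinP.
  apply: (measurableT_comp measurable_modulus (g := fun p : T * T => (dotp p.1 p.2, p.2))).
  by apply: measurable_fun_pair => //; exact: measurable_dotp2.
by move=> p; rewrite lee_fin modulus_ge0.
Qed.

Let abs_adjointE x :
  (abs_adjoint x = \int[S]_(w in sphere n) (Normc.normc (G (dotp x w, w)))%:E)%E.
Proof.
rewrite integral_mkcond; apply: eq_integral => w _.
rewrite /modulus !patchE.
have -> : ((dotp x w, w) \in D) = (w \in sphere n).
  by apply/idP/idP; rewrite !inE /=; [case|].
by case: ifP.
Qed.

Let measurable_slice (h : R * T -> R) x : measurable_fun D h ->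
  measurable_fun (sphere n) (fun w => (h (dotp x w, w))%:E).
Proof.
move=> mh; apply/measurable_EFinP.
apply: (@measurable_comp _ _ _ _ _ _ D h _ (fun w : T => (dotp x w, w))) => //.
  by move=> _ [w sw <-]; split.
apply: measurable_funTS.
by apply: measurable_fun_pair => //; exact: measurable_dotp.
Qed.

Let ms : measurable (sphere n : set T). Proof. exact: measurable_sphere. Qed.

Let slice_le (h : R * T -> R) x : measurable_fun D h ->
  (forall p, `|h p| <= Normc.normc (G p)) ->
  (\int[S]_(w in sphere n) `|(h (dotp x w, w))%:E| <= abs_adjoint x)%E.
Proof.
move=> mh hG; rewrite abs_adjointE [leLHS]integral_mkcond [leRHS]integral_mkcond.
apply: le_integral_ge0 => w; rewrite !patchE; case: ifP => // _.
by rewrite lee_fin.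
Qed.

Lemma cintegrable_slice x : abs_adjoint x \is a fin_num ->
  cintegrable S (sphere n) (fun w => G (dotp x w, w)).
Proof.
have [mRe mIm] := mG.
rewrite ge0_fin_numE ?abs_adjoint_ge0// => ux.
split; apply/integrableP; split.
- exact: (measurable_slice _ mRe).
- apply: le_lt_trans (slice_le _ mRe _) ux => p; exact: Re_le_normc.
- exact: (measurable_slice _ mIm).
- apply: le_lt_trans (slice_le _ mIm _) ux => p; exact: Im_le_normc.
Qed.

(** The real and the imaginary parts are bounded separately, whence the factor
    2. *)
Lemma normc_adjoint_le x :
  ((Normc.normc (adjoint_radon G x))%:E <= 2%:E * abs_adjoint x)%E.
Proof.
have [mRe mIm] := mG.
have fine_le (e : \bar R) : ((`|fine e|)%:E <= `|e|)%E.
  by case: e => [r| |] //=; rewrite ?normr0 ?leey.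
have bound (h : R * T -> R) : measurable_fun D h ->
    (forall p, `|h p| <= Normc.normc (G p)) ->
    ((`|\int[S]_(w in sphere n) h (dotp x w, w)|)%:E <= abs_adjoint x)%E.
  move=> mh hG; apply: le_trans (slice_le x mh hG).
  apply: (le_trans (fine_le _)); apply: le_abse_integral => //.
  exact: measurable_slice.
apply: (@le_trans _ _ ((`|complex.Re (adjoint_radon G x)|)%:E +
    (`|complex.Im (adjoint_radon G x)|)%:E)%E).
  by rewrite -EFinD lee_fin normc_le.
have -> : (2%:E * abs_adjoint x = abs_adjoint x + abs_adjoint x)%E.
  by rewrite mule_natl mule2n.
apply: leeD.
  by apply: (bound _ mRe) => p; exact: Re_le_normc.
by apply: (bound _ mIm) => p; exact: Im_le_normc.
Qed.

End adjoint.

Lemma cLnorm_expr (d : measure_display) (T : measurableType d) (R : realType)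
    (mu : {measure set T -> \bar R}) (D : set T) (m : nat) (f : T -> R[i]) :
  cLnorm mu D m%:R f =
  ((\int[mu]_x ((((fun x => Normc.normc (f x)) \_ D) x) ^+ m)%:E) `^ m%:R^-1)%E.
Proof.
rewrite /cLnorm unlock /=; congr (_ `^ _)%E; apply: eq_integral => x _.
rewrite !patchE; case: ifPn => _ /=.
  by rewrite ger0_norm ?normc_ge0// powR_mulrn// normc_ge0.
by rewrite normr0 powR_mulrn.
Qed.

Lemma powR_rootK (R : realType) (m : nat) (a : R) : (0 < m)%N -> 0 <= a ->
  (a ^+ m) `^ m%:R^-1 = a.
Proof.
move=> m0 a0; rewrite -powR_mulrn// -powRrM mulfV ?powRr1//.
by rewrite pnatr_eq0 -lt0n.
Qed.

Section adjoint_shell.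
Context {R : realType} (n : nat) (gamma : R).
Hypotheses (n1 : (1 < n)%N) (gamma1 : 1 < gamma).
Local Notation T := (n.-tuple R).
Local Notation leb := (lebesgue_tuple R n).
Local Notation S := (sphere_measure R n).
Local Notation A := (shell n gamma).
Variables (G : R * T -> R[i]) (k : int).
Hypothesis mG : cmeasurable_fun ([set: R] `*` sphere n) G.
Local Notation u := (abs_adjoint G).
Hypothesis ufin : {ae leb, forall x, A k x -> u x \is a fin_num}.
Hypothesis massE :
  (\int[leb]_(x in A k) (fine (u x) ^+ (2 * n))%:E = (shell_mass gamma u k)%:E)%E.
Hypothesis mass0 : 0 <= shell_mass gamma u k.

(** Only the majorant [abs_adjoint G] is replaced by its finite version almost
    everywhere; the transform itself is compared with it pointwise. *)
Lemma adjoint_shell_le :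
  (cLnorm leb (A k) (2 * n)%:R (adjoint_radon G) <=
   (2 * rootn n (shell_mass gamma u k))%:E)%E.
Proof.
have n20 : (0 < 2 * n)%N by rewrite muln_gt0 (ltnW n1).
have mA : measurable (A k) by exact: measurable_shell.
have mu_ := measurable_abs_adjoint mG.
pose H x : \bar R := ((2%:E * u x) `^ (2 * n)%:R)%E.
have mH : measurable_fun setT H.
  apply: (measurableT_comp (measurable_poweR (2 * n)%:R)).
  exact: measurable_funeM.
have r0 : 0 <= rootn n (shell_mass gamma u k) by exact: powR_ge0.
rewrite cLnorm_expr -[X in (_ <= X%:E)%E](powR_rootK n20) ?mulr_ge0//.
rewrite -poweR_EFin; apply: gt0_ler_poweR; rewrite ?invr_ge0//.
- rewrite in_itv/= leey andbT; apply: integral_ge0 => x _.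
  rewrite lee_fin exprn_ge0// patchE; case: ifP => // _; exact: normc_ge0.
- by rewrite in_itv/= leey andbT lee_fin exprn_ge0 ?mulr_ge0.
apply: (@le_trans _ _ (\int[leb]_(x in A k) H x)%E).
  rewrite [leRHS]integral_mkcond; apply: le_integral_ge0 => x.
    rewrite lee_fin exprn_ge0// patchE; case: ifP => // _; exact: normc_ge0.
  rewrite !patchE; case: ifP => _; last by rewrite expr0n gtn_eqF.
  rewrite -powR_mulrn ?normc_ge0// -poweR_EFin; apply: gt0_ler_poweR => //.
  - by rewrite in_itv/= leey andbT lee_fin; exact: sqrtr_ge0.
  - by rewrite in_itv/= leey andbT mule_ge0 ?abs_adjoint_ge0.
  - exact: normc_adjoint_le.
rewrite (@ge0_ae_eq_integral _ _ _ leb _ _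
  (fun x => (2 ^+ (2 * n))%:E * (fine (u x) ^+ (2 * n))%:E)%E)//.
- rewrite ge0_integralZl//.
  + by rewrite massE -EFinM exprMn rootnK.
  + apply/measurable_EFinP/measurable_funTS/measurable_funX.
    exact: measurableT_comp.
  + by move=> x _; rewrite lee_fin exprn_ge0// fine_ge0// abs_adjoint_ge0.
- exact: measurable_funTS.
- apply: measurable_funeM; apply/measurable_EFinP/measurable_funTS/measurable_funX.
  exact: measurableT_comp.
- by move=> x _; exact: poweR_ge0.
- by move=> x _; rewrite -EFinM lee_fin mulr_ge0 ?exprn_ge0// fine_ge0// abs_adjoint_ge0.
- apply: filterS ufin => x Hx Ax; have uf := Hx Ax.
  rewrite /H -{1}[u x]fineK// -EFinM poweR_EFin powR_mulrn ?exprMn//.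
  by rewrite mulr_ge0// fine_ge0// abs_adjoint_ge0.
Qed.

End adjoint_shell.

Theorem corollary1p8 (R : realType) (d : nat) (hd : (4 <= d)%N)
    (gamma : R) (hgamma : 1 < gamma) :
  exists C : R, 0 < C /\
    forall G : R * d.-tuple R -> R[i],
      cLfun (lebesgue_measure \x sphere_measure R d)%E
        ([set: R] `*` sphere d) 2 G ->
      {ae lebesgue_tuple R d, forall x : d.-tuple R,
        cintegrable (sphere_measure R d) (sphere d)
          (fun w => G (dotp x w, w))} /\
      ((\esum_(k in [set: int])
          (cLnorm (lebesgue_tuple R d) (shell d gamma k) (2 * d)%:R
            (adjoint_radon G) `^ 2)) `^ 2^-1
       <= C%:E * cLnorm (lebesgue_measure \x sphere_measure R d)
            ([set: R] `*` sphere d) 2 G)%E.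
Proof.
have d1 : (1 < d)%N by apply: leq_trans hd.
have d0 : (0 < d)%N by apply: leq_trans d1.
pose K : R := 4 * radon_const d * schur_const d gamma.
have c0 : 0 < radon_const d :> R by rewrite mulr_gt0 ?exprn_gt0// ltr0n.
have K0 : 0 < K by rewrite mulr_gt0 ?schur_const_gt0// mulr_gt0.
exists (Num.sqrt (4 * K)); split; first by rewrite sqrtr_gt0 mulr_gt0.
move=> G [mG Gfin].
set N := cLnorm (lebesgue_measure \x sphere_measure R d)%E ([set: R] `*` sphere d) 2 G.
pose u := abs_adjoint G.
pose X := (\int[lebesgue_measure \x sphere_measure R d]_p (modulus G p ^+ 2)%:E)%E.
have X0 : (0 <= X)%E by apply: integral_ge0 => p _; rewrite lee_fin sqr_ge0.
have NX : N = (X `^ 2^-1)%E by rewrite /N cLnorm_expr.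
have Xfin : X \is a fin_num.
  rewrite ge0_fin_numE//; move: Gfin; rewrite -/N NX; apply: lty_poweRy.
  by rewrite invr_eq0 pnatr_eq0.
have XE : X = (fine X)%:E by rewrite fineK.
have x0 : 0 <= fine X by exact: fine_ge0.
have mu_ := measurable_abs_adjoint mG.
have u0 := abs_adjoint_ge0 G.
have pair (f : d.-tuple R -> R) : measurable_fun setT f -> (forall x, 0 <= f x) ->
    forall l, 0 < l -> (\int[lebesgue_tuple R d]_x ((f x)%:E * u x) <=
      l%:E * (fine X)%:E + (l^-1 * radon_const d)%:E * newton_energy f)%E.
  move=> mf f0 l l0; rewrite -XE.
  exact: (radon_pairing_le d0 mf f0 (measurable_modulus mG) (modulus_ge0 G) l0).
have ufin := ae_shell_fin d1 hgamma mu_ u0 x0 c0 pair.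
split.
  apply: (ae_shells d0 hgamma) => k; apply: filterS (ufin k) => x H Ax.
  by apply: cintegrable_slice => //; exact: H.
have mE := shell_massE d1 hgamma mu_ u0 x0 c0 pair.
have m0 := shell_mass_ge0 d1 hgamma mu_ u0 x0 c0 pair.
have total : (\esum_(k in [set: int])
    (cLnorm (lebesgue_tuple R d) (shell d gamma k) (2 * d)%:R
      (adjoint_radon G) `^ 2) <= (4 * K * fine X)%:E)%E.
  apply: ge_ereal_sup => _ [F [finF _] <-]; rewrite fsbig_finite//=.
  apply: (@le_trans _ _ (\sum_(k <- finmap.enum_fset (fset_set F))
      (4 * rootn d (shell_mass gamma u k) ^+ 2)%:E)%E).
    apply: lee_sum => k _.
    have r0 : 0 <= rootn d (shell_mass gamma u k) by exact: powR_ge0.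
    have h := adjoint_shell_le d1 mG (ufin k) (mE k) (m0 k).
    apply: (@le_trans _ _ ((2 * rootn d (shell_mass gamma u k))%:E `^ 2)%E).
      apply: gt0_ler_poweR => //.
        by rewrite in_itv/= leey andbT; exact: Lnorm_ge0.
      by rewrite in_itv/= leey andbT lee_fin mulr_ge0.
    rewrite poweR_EFin powR_mulrn ?mulr_ge0// lee_fin exprMn.
    by rewrite -natrX.
  rewrite sumEFin lee_fin -mulr_sumr -mulrA ler_wpM2l//.
  exact: (sum_shell_mass d1 hgamma mu_ u0 x0 c0 pair (finmap.fset_uniq _)).
rewrite NX.
have -> : ((Num.sqrt (4 * K))%:E * X `^ 2^-1 = (4 * K * fine X)%:E `^ 2^-1)%E.
  rewrite [in LHS]XE !poweR_EFin -EFinM; congr EFin.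
  have K4 : 0 <= 4 * K by rewrite mulr_ge0// ltW.
  by rewrite powRM// (powR12_sqrt K4).
apply: gt0_ler_poweR => //.
- by rewrite in_itv/= leey andbT; apply: esum_ge0 => k _; exact: poweR_ge0.
- by rewrite in_itv/= leey andbT lee_fin mulr_ge0// mulr_ge0 ?(ltW K0).
Qed.
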